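(* Let $n\ge1$, $2\le\alpha\le2n$, $\gamma>0$, let $M\ge0$ be a constant, and set $q=(2n+\gamma)/\alpha-1$. Let $f\in\mathcal{C}^3(\mathbb{B}^n)$ satisfy $$|\Delta f(z)|\le a(z)\|D_f(z)\|+b(z)|f(z)|+c(z)\quad(z\in\mathbb{B}^n)$$ for real-valued nonnegative continuous functions $a,b,c$ on $\mathbb{B}^n$ with $\sup_{\mathbb{B}^n}a<\infty$, $\sup_{\mathbb{B}^n}b<\infty$ and $c(z)\le M\,d(z)^{-q}$, and suppose $f\in\mathcal{D}_{\gamma,\alpha}(\mathbb{B}^n)$, $\mathrm{Re}(f\overline{\Delta f})\ge0$ and $$\mathrm{Re}\Big\{\sum_{k=1}^{n}\big[\overline{f_{z_{k}}}(\Delta f)_{z_{k}}+\overline{f_{\overline{z}_{k}}}(\Delta f)_{\overline{z}_{k}}\big]\Big\}\ge0$$ in $\mathbb{B}^n$. Then for every $p\ge2$, $$\int_{\mathbb{B}^{n}}d(z)^{pq}\,\Delta\big(|f(z)|^{p}\big)\,dV_{N}(z)<\infty.$$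
   Context: $\mathbb{B}^n$ is the open unit ball of $\mathbb{C}^n$, $d(z)=1-|z|$, $dV_N$ the normalized volume measure, $\Delta=4\sum_k\partial^2/\partial z_k\partial\overline{z}_k$. $D_f=(f_{z_1},\dots,f_{z_n},f_{\overline z_1},\dots,f_{\overline z_n})$ and $\|D_f\|=\big(\sum_k(|f_{z_k}|^2+|f_{\overline z_k}|^2)\big)^{1/2}$. For $\nu\ge0$ and $0<t<\infty$, the Dirichlet-type space $\mathcal{D}_{\nu,t}(\mathbb{B}^n)$ consists of all $f\in\mathcal{C}^1(\mathbb{B}^n)$ with $\int_{\mathbb{B}^n}d(z)^{\nu}\|D_f(z)\|^{t}\,dV_N(z)<\infty$ (norm $|f(0)|+(\int d^\nu\|D_f\|^t dV_N)^{1/t}$). *)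

(* Defs.v *)
From HB Require Import structures.
From mathcomp Require Import all_boot all_algebra.
From mathcomp Require Import all_classical all_reals all_analysis.
From mathcomp.real_closed Require Import complex.

Set Implicit Arguments.
Unset Strict Implicit.
Unset Printing Implicit Defensive.

Import GRing.Theory Num.Theory.
Import numFieldNormedType.Exports.

Local Open Scope ring_scope.
Local Open Scope classical_set_scope.

(* A point z = (z_1,...,z_n) of C^n is encoded by its real coordinates      *)
(* w : 'rV[R]_(n + n), with  Re z_k = w 0 (lshift n k)  and                 *)
(*                          Im z_k = w 0 (rshift n k).                      *)
(* Functions f : B^n -> C are functions 'rV[R]_(n+n) -> R[i] (only their    *)
(* values on the ball matter).                                              *)

Section Defs.
Variable R : realType.
Variable n : nat.

Notation pt := 'rV[R]_(n + n).

Definition xco (w : pt) (k : 'I_n) : R := w ord0 (lshift n k).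
Definition yco (w : pt) (k : 'I_n) : R := w ord0 (rshift n k).

Definition enorm (w : pt) : R :=
  Num.sqrt (\sum_(k < n) (xco w k ^+ 2 + yco w k ^+ 2)).

Definition ball_n : set pt := [set w | enorm w < 1].
Definition dist_bd (w : pt) : R := 1 - enorm w.

Definition cabs (z : R[i]) : R := Normc.normc z.

Definition pdR (j : 'I_(n + n)) (g : pt -> R) : pt -> R :=
  fun w => 'D_(delta_mx ord0 j) g w.

Definition reF (f : pt -> R[i]) : pt -> R := fun w => complex.Re (f w).
Definition imF (f : pt -> R[i]) : pt -> R := fun w => complex.Im (f w).

Definition pdC (j : 'I_(n + n)) (f : pt -> R[i]) : pt -> R[i] :=
  fun w => ((pdR j (reF f) w) +i* (pdR j (imF f) w))%C.

Definition dz (k : 'I_n) (f : pt -> R[i]) : pt -> R[i] :=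
  fun w => (pdC (lshift n k) f w - 'i%C * pdC (rshift n k) f w) / 2%:R.
Definition dzb (k : 'I_n) (f : pt -> R[i]) : pt -> R[i] :=
  fun w => (pdC (lshift n k) f w + 'i%C * pdC (rshift n k) f w) / 2%:R.

Definition lap (f : pt -> R[i]) : pt -> R[i] :=
  fun w => 4%:R * \sum_(k < n) dz k (dzb k f) w.

Definition normDf (f : pt -> R[i]) (w : pt) : R :=
  Num.sqrt (\sum_(k < n) (cabs (dz k f w) ^+ 2 + cabs (dzb k f w) ^+ 2)).

Fixpoint CkR (k : nat) (g : pt -> R) : Prop :=
  (forall w, ball_n w -> {for w, continuous g}) /\
  match k with
  | 0 => True
  | k'.+1 => forall j : 'I_(n + n),
      (forall w, ball_n w -> derivable g w (delta_mx ord0 j)) /\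
      CkR k' (pdR j g)
  end.

Definition CkC (k : nat) (f : pt -> R[i]) : Prop :=
  CkR k (reF f) /\ CkR k (imF f).

(* Lebesgue integration on R^m, for nonnegative functions, as the iterated  *)
(* one-dimensional Lebesgue integral (Tonelli); the m-dimensional Lebesgue  *)
(* measure is not available in the library.                                *)
Fixpoint iint (m : nat) : (('I_m -> R) -> \bar R) -> \bar R :=
  match m with
  | 0 => fun g => g (fun _ => 0)
  | m'.+1 => fun g =>
      (\int[@lebesgue_measure R]_(t in [set: R])
        iint (fun x : 'I_m' -> R =>
               g (fun i : 'I_m'.+1 =>
                    match unlift ord0 i with
                    | None => t
                    | Some j => x j
                    end)))%E
  end.

Definition vint (g : pt -> \bar R) : \bar R :=
  iint (fun x : 'I_(n + n) -> R => g (\row_j x j)).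

Definition vol_ball : \bar R :=
  vint (fun w => if (enorm w < 1)%R then 1%E else 0%E).

Definition intVN (h : pt -> R) : \bar R :=
  ((fine vol_ball)^-1%:E * vint (fun w => if (enorm w < 1)%R then (h w)%:E else 0%E))%E.

Definition Dirichlet (nu t : R) (f : pt -> R[i]) : Prop :=
  CkC 1 f /\
  (intVN (fun w => (dist_bd w `^ nu * normDf f w `^ t)%R) < +oo)%E.

End Defs.

(* Main.v *)
(** Write D for the gradient of f. The second positivity hypothesis makes the
    square of the norm of D subharmonic, so its power [alpha / 2 >= 1] satisfies
    a sub-mean value inequality on the ball of radius [d(z) / 2] around [z];
    together with membership in the Dirichlet space this gives
    [|D(z)| <= C d(z)^-(q+1)], and integrating along radii [|f(z)| <= C d(z)^-q].
    The Laplacian of [|f|^p] is at most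
    [|f|^(p-2) (2 p^2 |D|^2 + p |f| |lap f|)], so that the integrand is bounded by
    a constant times [d^(2q) |D|^2 + 1], and [d^(2q) |D|^2 <= d^gamma |D|^alpha + 1]
    because [2 q - 2 gamma / alpha = 4 n / alpha - 2 >= 0].

    The mean value inequality is proved with the weights
    [(t - |w - z|^2)_+^2]: for subharmonic [l], the weighted integral [E(t)]
    satisfies [t E'(t) >= (n + 2) E(t)] by two integrations by parts, so
    [t^-(n+2) E(t)] is nondecreasing, and it is nonnegative for small [t] as soon
    as [l(z) > 0]. Only iterated integrals of compactly supported continuous
    functions occur; the integrals over the whole ball are reached by monotone
    convergence. *)
Require Import Defs.
From HB Require Import structures.
From mathcomp Require Import all_boot all_order all_algebra.
From mathcomp Require Import all_classical all_reals all_analysis.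
From mathcomp.real_closed Require Import complex.
From mathcomp Require Import ring lra.

Set Implicit Arguments.
Unset Strict Implicit.
Unset Printing Implicit Defensive.

Import Order.TTheory GRing.Theory Num.Theory.
Import numFieldNormedType.Exports.

Local Open Scope ring_scope.
Local Open Scope classical_set_scope.

(** * Iterated integrals of continuous functions supported in the unit cube *)

(** Since the integral is built one coordinate at a time, spheres, polar coordinates and changes of
    variables are avoided: everything is done with functions that are uniformly continuous and
    vanish off the cube [-1, 1]^(2n), a class stable under freezing a coordinate, so that properties
    of the integral follow by induction from dimension one. This dictates the weights: the truncated
    paraboloid is polynomial on its support, its partial derivatives reproduce lower powers of it
    times w_k - z_k, and its square is already C^1. The exponent n + 2 is the homogeneity of the
    weighted integral of a constant: the volume gives t^n for squared radius t, the squared weight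
    gives t^2.

    A second obstacle is that |D|^alpha and |f|^p need not be smooth at zeros. For the former, a
    convexity inequality is integrated against the weight, so that only |D|^2 is differentiated
    twice. For the latter, powers of |f|^2 are always differentiated together with a factor
    vanishing at the zeros of f. The integrand being an absolute value, the Laplacian of |f|^p is
    estimated from both sides. *)

Section IteratedIntegral.
Variable R : realType.
Local Notation mu := (@lebesgue_measure R).

(* Convertible to the point at which the integrand of [iint] is evaluated. *)
Definition fcons m (t : R) (x : 'I_m -> R) : 'I_m.+1 -> R :=
  fun i => match unlift ord0 i with None => t | Some j => x j end.

Definition unifc m (F : ('I_m -> R) -> R) := forall e, 0 < e ->
  exists2 d, 0 < d &
    forall x y, (forall i, `|x i - y i| <= d) -> `|F x - F y| <= e.

Definition ucc m (F : ('I_m -> R) -> R) :=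
  unifc F /\ forall x i, 1 < `|x i| -> F x = 0.

(** Real-valued twin of [iint]: the two agree on [ucc] functions, where sums and scalings can then
    be handled without extended reals. *)
Fixpoint iintR m : (('I_m -> R) -> R) -> R :=
  match m with
  | 0 => fun F => F (fun _ => 0)
  | m'.+1 => fun F => \int[mu]_(t in setT) iintR (fun x => F (fcons t x))
  end.

Lemma fcons0 m t (x : 'I_m -> R) : fcons t x ord0 = t.
Proof. by rewrite /fcons unlift_none. Qed.

Lemma fconsS m t (x : 'I_m -> R) i : fcons t x (lift ord0 i) = x i.
Proof. by rewrite /fcons liftK. Qed.

Lemma fcons_le m (d t s : R) (x y : 'I_m -> R) : `|t - s| <= d ->
  (forall i, `|x i - y i| <= d) -> forall i, `|fcons t x i - fcons s y i| <= d.
Proof. by move=> ts xy i; rewrite /fcons; case: unliftP. Qed.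

Lemma ucc_fcons m (F : ('I_m.+1 -> R) -> R) t :
  ucc F -> ucc (fun x => F (fcons t x)).
Proof.
move=> [cF sF]; split => [e e0|x i xi].
  have [d d0 Fd] := cF e e0; exists d => // x y xy; apply: Fd.
  by apply: fcons_le => //; rewrite subrr normr0 ltW.
by apply: (sF _ (lift ord0 i)); rewrite fconsS.
Qed.

Lemma ucc_lin m (F G : ('I_m -> R) -> R) a :
  ucc F -> ucc G -> ucc (fun x => a * F x + G x).
Proof.
move=> [cF sF] [cG sG]; split => [e e0|x i xi]; last first.
  by rewrite (sF _ i)// (sG _ i)// mulr0 addr0.
have a1 : 0 < `|a| + 1 by rewrite ltr_wpDl.
have e2 : 0 < e / 2 by rewrite divr_gt0.
have [d d0 Fd] := cF (e / 2 / (`|a| + 1)) (divr_gt0 e2 a1).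
have [d' d'0 Gd] := cG (e / 2) e2.
exists (Num.min d d'); first by rewrite lt_min d0.
move=> x y xy.
have h1 : `|F x - F y| <= e / 2 / (`|a| + 1).
  by apply: Fd => i; have := xy i; rewrite le_min => /andP[].
have h2 : `|G x - G y| <= e / 2.
  by apply: Gd => i; have := xy i; rewrite le_min => /andP[].
have -> : a * F x + G x - (a * F y + G y) = a * (F x - F y) + (G x - G y) by ring.
rewrite (le_trans (ler_normD _ _))// (splitr e) lerD// normrM.
rewrite ler_pdivlMr// in h1; apply: le_trans h1.
by rewrite mulrC ler_wpM2l// lerDl.
Qed.

Definition cc1 (phi : R -> R) :=
  continuous phi /\ forall t, 1 < `|t| -> phi t = 0.

Lemma cc1_patch phi L : 1 <= L -> cc1 phi -> phi \_ `[- L, L] = phi.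
Proof.
move=> L1 [_ s]; apply/funext => t; rewrite /patch; case: ifPn => //.
rewrite notin_setE/= in_itv/= -ler_norml => /negP; rewrite -ltNge => h.
by rewrite s// (le_lt_trans L1).
Qed.

Lemma cc1_integrable phi : cc1 phi -> mu.-integrable setT (EFin \o phi).
Proof.
move=> c; rewrite -(cc1_patch (lexx 1) c) -restrict_EFin.
apply/(@integrable_mkcond _ _ _ mu _ (EFin \o phi)) => //.
apply: continuous_compact_integrable; first exact: segment_compact.
exact/continuous_subspaceT/c.1.
Qed.

Lemma cc1_Rintegral phi L : 1 <= L -> cc1 phi ->
  \int[mu]_(t in setT) phi t = \int[mu]_(t in `[- L, L]) phi t.
Proof. by move=> L1 c; rewrite [RHS]Rintegral_mkcond cc1_patch. Qed.

Lemma cc1_bound phi K : cc1 phi -> (forall t, `|phi t| <= K) ->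
  `|\int[mu]_(t in setT) phi t| <= 2 * K.
Proof.
move=> c phiK; rewrite (cc1_Rintegral (lexx 1) c).
have i1 : mu.-integrable `[- (1:R), 1] (EFin \o phi).
  apply: continuous_compact_integrable; first exact: segment_compact.
  exact/continuous_subspaceT/c.1.
apply: le_trans (le_normr_Rintegral _ i1) _ => //.
have -> : 2 * K = \int[mu]_(t in `[- 1, 1]) K.
  rewrite Rintegral_cst//= lebesgue_measure_itv/= lte_fin.
  by rewrite ifT; [rewrite /= opprK mulrC|lra].
apply: le_Rintegral => //.
- apply: continuous_compact_integrable; first exact: segment_compact.
  apply/continuous_subspaceT => x.
  by apply: continuous_comp; [exact: c.1|exact: norm_continuous].
- apply: continuous_compact_integrable; first exact: segment_compact.
  by apply/continuous_subspaceT => x; exact: cst_continuous.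
Qed.

(** Bundled for the induction: linearity and the sup bound in dimension m make the slice integrals
    continuous, hence integrable, and every clause in dimension m + 1 relies on this. The factor
    [2 ^+ m] is the volume of the cube. *)
Definition iintR_spec m :=
  [/\ forall F : ('I_m -> R) -> R, ucc F -> iint (EFin \o F) = (iintR F)%:E,
      forall a (F G : ('I_m -> R) -> R), ucc F -> ucc G ->
        iintR (fun x => a * F x + G x) = a * iintR F + iintR G,
      forall F G : ('I_m -> R) -> R, ucc F -> ucc G -> (forall x, F x <= G x) ->
        iintR F <= iintR G
    & forall (F : ('I_m -> R) -> R) K, ucc F -> (forall x, `|F x| <= K) ->
        `|iintR F| <= 2 ^+ m * K].

Lemma iintR_spec_cc1 m (F : ('I_m.+1 -> R) -> R) : iintR_spec m -> ucc F ->
  cc1 (fun t => iintR (fun x => F (fcons t x))).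
Proof.
move=> [_ lin _ bnd] uF; split => [t|t t1]; last first.
  (* A slice beyond the cube is identically zero, so the sup bound applies with [K] = 0. *)
  have := bnd _ 0 (ucc_fcons t uF) _; rewrite mulr0 normr_le0 => h.
  apply/eqP/h => x; have -> : F (fcons t x) = 0.
    by apply: (uF.2 _ ord0); rewrite fcons0.
  by rewrite normr0.
apply/cvgrPdist_le => e e0.
have p0 : 0 < 2 ^+ m :> R by rewrite exprn_gt0.
have [d d0 Fd] := uF.1 (e / 2 ^+ m) (divr_gt0 e0 p0).
near=> s.
have -> : iintR (fun x => F (fcons t x)) - iintR (fun x => F (fcons s x)) =
    iintR (fun x => -1 * F (fcons s x) + F (fcons t x)).
  by rewrite lin; [ring|exact: ucc_fcons|exact: ucc_fcons].
have -> : e = 2 ^+ m * (e / 2 ^+ m) by field; rewrite gt_eqF.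
apply: bnd; first by apply: ucc_lin; exact: ucc_fcons.
move=> x; rewrite mulN1r addrC; apply: Fd; apply: fcons_le.
  by near: s; exact: cvgr_dist_le.
by move=> i; rewrite subrr normr0 ltW.
Unshelve. all: by end_near. Qed.

Lemma iintRP m : iintR_spec m.
Proof.
elim: m => [|m IH].
  split=> //=.
  by move=> F K _ h; rewrite expr0 mul1r.
have c1 F (uF : ucc F) := iintR_spec_cc1 IH uF.
case: (IH) => E lin mono bnd; split.
- move=> F uF /=.
  have -> : (fun t : R => iint (fun x : 'I_m -> R => (EFin \o F) (fun i =>
      match unlift ord0 i with Some j => x j | None => t end))) =
      EFin \o (fun t => iintR (fun x => F (fcons t x))).
    by apply/funext => t /=; rewrite -E//; exact: ucc_fcons.
  rewrite /Rintegral fineK//; apply: integrable_fin_num => //.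
  exact: cc1_integrable (c1 _ uF).
- move=> a F G uF uG /=.
  have -> : (fun t : R => iintR (fun x => a * F (fcons t x) + G (fcons t x))) =
      fun t => a * iintR (fun x => F (fcons t x)) + iintR (fun x => G (fcons t x)).
    by apply/funext => t; rewrite lin//; exact: ucc_fcons.
  have iF := cc1_integrable (c1 _ uF); have iG := cc1_integrable (c1 _ uG).
  rewrite RintegralD ?RintegralZl//.
  have -> : EFin \o (fun x : R => a * iintR (fun x0 => F (fcons x x0))) =
    (fun x => a%:E * (EFin \o (fun t => iintR (fun x0 => F (fcons t x0)))) x)%E.
    by apply/funext => x /=; rewrite EFinM.
  exact: integrableZl.
- move=> F G uF uG FG /=; apply: le_Rintegral => //.
  + exact: cc1_integrable (c1 _ uF).
  + exact: cc1_integrable (c1 _ uG).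
  + by move=> t _; apply: mono => [||x]; [exact: ucc_fcons..|exact: FG].
- move=> F K uF FK /=; rewrite exprS -mulrA; apply: cc1_bound; first exact: c1.
  by move=> t; apply: bnd => //; exact: ucc_fcons.
Qed.

Lemma iint_ucc m (F : ('I_m -> R) -> R) : ucc F -> iint (EFin \o F) = (iintR F)%:E.
Proof. by case: (iintRP m) => + _ _ _; exact. Qed.

Lemma iintR_lin m a (F G : ('I_m -> R) -> R) : ucc F -> ucc G ->
  iintR (fun x => a * F x + G x) = a * iintR F + iintR G.
Proof. by case: (iintRP m) => _ + _ _; exact. Qed.

Lemma le_iintR m (F G : ('I_m -> R) -> R) : ucc F -> ucc G ->
  (forall x, F x <= G x) -> iintR F <= iintR G.
Proof. by case: (iintRP m) => _ _ + _; exact. Qed.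

Lemma iintR_norm_le m (F : ('I_m -> R) -> R) K : ucc F ->
  (forall x, `|F x| <= K) -> `|iintR F| <= 2 ^+ m * K.
Proof. by case: (iintRP m) => _ _ _; exact. Qed.

Lemma ucc0 m : ucc (fun _ : 'I_m -> R => 0).
Proof.
by split => // e e0; exists 1 => // x y _; rewrite subrr normr0 ltW.
Qed.

Lemma iintR0 m : iintR (fun _ : 'I_m -> R => 0) = 0.
Proof.
apply/eqP; rewrite -normr_le0.
have := iintR_norm_le (@ucc0 m) (K := 0); rewrite mulr0; apply => _.
by rewrite normr0.
Qed.

Lemma ucc_scale m a (F : ('I_m -> R) -> R) : ucc F -> ucc (fun x => a * F x).
Proof.
move=> uF; have := ucc_lin a uF (@ucc0 m).
by under eq_fun do rewrite addr0.
Qed.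

Lemma iintR_scale m a (F : ('I_m -> R) -> R) : ucc F ->
  iintR (fun x => a * F x) = a * iintR F.
Proof.
move=> uF; have := iintR_lin a uF (@ucc0 m).
by under eq_fun do rewrite addr0; rewrite iintR0 addr0.
Qed.

Lemma ucc_add m (F G : ('I_m -> R) -> R) :
  ucc F -> ucc G -> ucc (fun x => F x + G x).
Proof.
by move=> uF uG; have := ucc_lin 1 uF uG; under eq_fun do rewrite mul1r.
Qed.

Lemma iintR_add m (F G : ('I_m -> R) -> R) : ucc F -> ucc G ->
  iintR (fun x => F x + G x) = iintR F + iintR G.
Proof.
by move=> uF uG; have := iintR_lin 1 uF uG; under eq_fun do rewrite mul1r; rewrite mul1r.
Qed.

Lemma ucc_sum m (I : Type) (s : seq I) (F : I -> ('I_m -> R) -> R) :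
  (forall i, ucc (F i)) -> ucc (fun x => \sum_(i <- s) F i x).
Proof.
move=> uF; elim: s => [|i s IH]; first by under eq_fun do rewrite big_nil; exact: ucc0.
by under eq_fun do rewrite big_cons; exact: ucc_add.
Qed.

Lemma iintR_sum m (I : Type) (s : seq I) (F : I -> ('I_m -> R) -> R) :
  (forall i, ucc (F i)) ->
  iintR (fun x => \sum_(i <- s) F i x) = \sum_(i <- s) iintR (F i).
Proof.
move=> uF; elim: s => [|i s IH].
  by under eq_fun do rewrite big_nil; rewrite big_nil iintR0.
by under eq_fun do rewrite big_cons; rewrite big_cons iintR_add ?IH//; exact: ucc_sum.
Qed.

Definition shift_coord m (k : 'I_m) (h : R) (x : 'I_m -> R) : 'I_m -> R :=
  fun i => x i + (if i == k then h else 0).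

(** Induction on the dimension, with no exchange of integrals. If the coordinate is the outermost
    one, the uniform difference quotients allow differentiation under the inner integral and the
    fundamental theorem of calculus concludes; otherwise each slice already integrates to zero. *)
Lemma iintR_derive_eq0 m (k : 'I_m) (F F' : ('I_m -> R) -> R) :
  ucc F -> ucc F' ->
  (forall e, 0 < e -> exists2 d, 0 < d & forall x h, `|h| <= d ->
     `|F (shift_coord k h x) - F x - h * F' x| <= e * `|h|) ->
  iintR F' = 0.
Proof.
elim: m k F F' => [[]//|m IH] k F F' uF uF' dF.
case: (unliftP ord0 k) => [k'|] kE /=; last first.
  pose phi t := iintR (fun x => F (fcons t x)).
  pose psi t := iintR (fun x => F' (fcons t x)).
  have cphi : cc1 phi by apply: iintR_spec_cc1 => //; exact: iintRP.
  have cpsi : cc1 psi by apply: iintR_spec_cc1 => //; exact: iintRP.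
  have dphi (t : R) : is_derive t 1 phi (psi t).
    suff L : (fun h => h^-1 *: (phi (h *: 1 + t) - phi t)) @ 0^' --> psi t.
      split; first by apply/cvg_ex; exists (psi t).
      by apply/cvg_lim.
    apply/cvgrPdist_le => e e0.
    have p0 : 0 < 2 ^+ m :> R by rewrite exprn_gt0.
    have [d d0 Fd] := dF (e / 2 ^+ m) (divr_gt0 e0 p0).
    near=> h.
    have h0 : h != 0 by near: h; exact: nbhs_dnbhs_neq.
    have hd : `|h| <= d.
      by near: h; apply: dnbhs0_le.
    rewrite distrC -(@ler_pM2l _ `|h|) ?normr_gt0// -normrM mulrBr.
    rewrite [_ *: 1]mulr1 /GRing.scale/= mulVKf//.
    have -> : phi (h + t) - phi t - h * psi t =
        iintR (fun x => (- h) * F' (fcons t x) +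
             (-1 * F (fcons t x) + F (fcons (h + t) x))).
      rewrite iintR_lin; [|exact: ucc_fcons|by apply: ucc_lin; exact: ucc_fcons].
      by rewrite iintR_lin; [rewrite /phi /psi; ring|exact: ucc_fcons..].
    have -> : `|h| * e = 2 ^+ m * (e / 2 ^+ m * `|h|) by field; rewrite gt_eqF.
    apply: iintR_norm_le.
      by apply: ucc_lin; [|apply: ucc_lin]; exact: ucc_fcons.
    move=> x.
    have -> : fcons (h + t) x = shift_coord k h (fcons t x).
      apply/funext => i; rewrite /shift_coord kE /fcons.
      by case: (unliftP ord0 i) => [j|] -> /=; rewrite ?addr0// addrC.
    have -> : forall a b c : R, - a * b + (-1 * c + F (shift_coord k a (fcons t x)))
       = F (shift_coord k a (fcons t x)) - c - a * b by move=> *; ring.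
    exact: Fd.
  (* On [-2, 2] the function [phi] is zero at both endpoints by the support condition, which says
     nothing directly at -1 and 1. *)
  have := @continuous_FTC2 R psi phi (-2) 2.
  rewrite (cc1_Rintegral (L := 2) _ cpsi) ?ler1n// /Rintegral => ->//=.
  - rewrite !(cphi.2) ?subrr// ?normrN ger0_norm// ?ltr1n//.
  - lra.
  - exact/continuous_subspaceT/cpsi.1.
  - split.
    + by move=> x _; exact: ex_derive.
    + by apply: cvg_at_right_filter; exact: cphi.1.
    + by apply: cvg_at_left_filter; exact: cphi.1.
  - by move=> x _; rewrite derive1E derive_val.
rewrite (_ : (fun t => _) = fun=> 0); first by rewrite Rintegral_cst// mul0r.
apply/funext => t; apply: (IH k' (fun x => F (fcons t x))); [exact: ucc_fcons..|].
move=> e e0; have [d d0 Fd] := dF e e0; exists d => // x h hd.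
have -> : fcons t (shift_coord k' h x) = shift_coord k h (fcons t x).
  apply/funext => i; rewrite /shift_coord kE.
  case: (unliftP ord0 i) => [j|] ->; first by rewrite !fconsS (inj_eq (lift_inj)).
  by rewrite !fcons0 eq_liftF addr0.
exact: Fd.
Unshelve. all: by end_near. Qed.

(* No measurability is needed: the integral of a nonnegative function is a
   supremum over the simple functions below it. *)
Lemma le_integral_ge0 (f g : R -> \bar R) : (forall t, (0 <= f t)%E) ->
  (forall t, (f t <= g t)%E) ->
  (\int[mu]_(t in setT) f t <= \int[mu]_(t in setT) g t)%E.
Proof.
move=> f0 fg; have g0 t : (0 <= g t)%E by exact: le_trans (fg t).
rewrite !ge0_integralTE//; apply: le_ereal_sup => _ [h hf <-].
by exists h => // t; exact: le_trans (fg t).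
Qed.

Lemma le_iint m (F G : ('I_m -> R) -> \bar R) :
  (forall x, (0 <= F x)%E) -> (forall x, (F x <= G x)%E) ->
  (0 <= iint F)%E /\ (iint F <= iint G)%E.
Proof.
elim: m F G => [|m IH] F G F0 FG /=; first by split.
have H t := IH (fun x => F (fcons t x)) (fun x => G (fcons t x)) (fun x => F0 _)
   (fun x => FG _).
split; first by apply: integral_ge0 => t _; exact: (H t).1.
by apply: le_integral_ge0 => t; [exact: (H t).1|exact: (H t).2].
Qed.

(** Follows coordinate by coordinate from monotonicity alone, so [F] may be any nonnegative
    function. It bounds below both the volume of the ball and the mass of the weight. *)
Lemma iint_cube_ge m (F : ('I_m -> R) -> \bar R) (c : 'I_m -> R) (eta K : R) :
  0 < eta -> 0 <= K -> (forall x, (0 <= F x)%E) ->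
  (forall x, (forall i, `|x i - c i| <= eta) -> (K%:E <= F x)%E) ->
  ((K * (2 * eta) ^+ m)%:E <= iint F)%E.
Proof.
move=> eta0; elim: m F c => [|m IH] F c K0 F0 FK /=.
  by rewrite expr0 mulr1; apply: FK => -[].
pose D : set R := `[c ord0 - eta, c ord0 + eta].
pose K' := K * (2 * eta) ^+ m.
have K'0 : 0 <= K' by rewrite mulr_ge0// exprn_ge0// mulr_ge0// ltW.
have -> : (K * (2 * eta) ^+ m.+1)%:E = (\int[mu]_(t in D) (cst K'%:E) t)%E.
  have -> : (\int[mu]_(t in D) (cst K'%:E) t = K'%:E * mu D)%E.
    by apply: integral_cst; exact: measurable_itv.
  have -> : (mu D = (2 * eta)%:E)%E.
    rewrite /D lebesgue_measure_itv/= lte_fin ifT; last by lra.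
    by rewrite -EFinB; congr EFin; ring.
  by rewrite -EFinM; congr EFin; rewrite exprSr /K'; ring.
rewrite integral_mkcond; apply: le_integral_ge0 => t; rewrite /patch.
  by case: ifP.
have J0 : (0 <= iint (fun x => F (fcons t x)))%E.
  exact: (@le_iint _ _ (fun x => F (fcons t x)) _ _).1.
case: ifPn => [|_]; last exact: J0.
rewrite inE /D /= in_itv/= => /andP[t1 t2].
apply: (IH (fun x => F (fcons t x)) (fun i => c (lift ord0 i))) => // x hx.
apply: FK => i; case: (unliftP ord0 i) => [j|] ->; first by rewrite fconsS.
by rewrite fcons0 ler_norml; apply/andP; split; lra.
Qed.

(** One-dimensional monotone convergence, once per coordinate; the slice integrals are measurable
    because they are continuous, so [G] only has to be the pointwise limit. *)
Lemma iint_monotone_cvg m (F : nat -> ('I_m -> R) -> R) (G : ('I_m -> R) -> \bar R) :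
  (forall j, ucc (F j)) -> (forall j x, 0 <= F j x) ->
  (forall x, nondecreasing_seq (F ^~ x)) ->
  (forall x, (F j x)%:E @[j --> \oo] --> G x) ->
  (iintR (F j))%:E @[j --> \oo] --> iint G.
Proof.
elim: m F G => [|m IH] F G uF F0 ndF FG; first exact: FG.
pose phi j t := iintR (fun x => F j (fcons t x)).
have H t : (phi j t)%:E @[j --> \oo] --> iint (fun x => G (fcons t x)).
  apply: IH => [j|j x|x i j ij|x]; [exact: ucc_fcons|exact: F0|exact: ndF|exact: FG].
have cphi j : cc1 (phi j) by apply: iintR_spec_cc1 => //; exact: iintRP.
have -> : (fun j => (iintR (F j))%:E) =
    fun j => (\int[mu]_(t in setT) (EFin \o phi j) t)%E.
  apply/funext => j; rewrite /= /Rintegral fineK//.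
  exact: integrable_fin_num (cc1_integrable (cphi j)).
have -> : iint G = (\int[mu]_(t in setT) limn (fun j => (EFin \o phi j) t))%E.
  by apply: eq_integral => t _; apply/esym/cvg_lim => //; exact: H.
apply: (@cvg_monotone_convergence _ _ _ mu setT measurableT (fun j => EFin \o phi j)).
- by move=> j; exact: measurable_int (cc1_integrable (cphi j)).
- move=> j t _; rewrite lee_fin -(iintR0 m).
  by apply: le_iintR => [||x]; [exact: ucc0|exact: ucc_fcons|exact: F0].
- move=> t _ i j ij; rewrite lee_fin.
  by apply: le_iintR => [||x]; [exact: ucc_fcons..|exact: ndF].
Qed.

End IteratedIntegral.

(** * Directional derivatives *)

Section LineDerivatives.
Variables (R : realType) (V : normedModType R).
Implicit Types (F G : V -> R) (w v : V).

Lemma is_derive_lineP F w v (t d : R) :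
  is_derive t 1 (fun s => F (s *: v + w)) d <-> is_derive (t *: v + w) v F d.
Proof.
have E : (fun h : R => h^-1 *:
      (((fun s => F (s *: v + w)) \o shift t) (h *: 1) - F (t *: v + w))) =
    (fun h : R => h^-1 *: ((F \o shift (t *: v + w)) (h *: v) - F (t *: v + w))).
  by apply/funext => h /=; rewrite [_ *: 1]mulr1 scalerDl addrA.
by split => -[]; rewrite /derivable /derive ?E => ? ?; split;
  rewrite /derivable /derive ?E.
Qed.

Lemma is_derive_line0 F w v (d : R) :
  is_derive w v F d -> is_derive (0 : R) 1 (fun s => F (s *: v + w)) d.
Proof. by move=> h; apply/is_derive_lineP; rewrite scale0r add0r. Qed.

Lemma is_derive_of_line0 F w v (d : R) :
  is_derive (0 : R) 1 (fun s => F (s *: v + w)) d -> is_derive w v F d.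
Proof. by move=> /is_derive_lineP; rewrite scale0r add0r. Qed.

Lemma is_derive_add F G w v (d e : R) : is_derive w v F d -> is_derive w v G e ->
  is_derive w v (fun x => F x + G x) (d + e).
Proof. by move=> *; exact: is_deriveD. Qed.

Lemma is_derive_mul F G w v (d e : R) : is_derive w v F d -> is_derive w v G e ->
  is_derive w v (fun x => F x * G x) (d * G w + F w * e).
Proof.
move=> hF hG; apply: (is_derive_eq (is_deriveM hF hG)).
by rewrite addrC mulrC.
Qed.

Lemma is_derive_sqr F w v (d : R) : is_derive w v F d ->
  is_derive w v (fun x => F x ^+ 2) (2 * (F w * d)).
Proof.
move=> h; have -> : (fun x => F x ^+ 2) = fun x => F x * F x by [].
by apply: (is_derive_eq (is_derive_mul h h)); ring.
Qed.

Lemma is_derive_sum_ord n (F : 'I_n -> V -> R) w v (d : 'I_n -> R) :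
  (forall i, is_derive w v (F i) (d i)) ->
  is_derive w v (fun x => \sum_(i < n) F i x) (\sum_(i < n) d i).
Proof.
move=> h; have := is_derive_sum h; congr is_derive.
by apply/funext => x; rewrite fct_sumE.
Qed.

Lemma is_derive_comp1 (g : R -> R) F w v (a d : R) :
  is_derive (F w) 1 g a -> is_derive w v F d ->
  is_derive w v (fun x => g (F x)) (a * d).
Proof.
move=> hg hF; apply: is_derive_of_line0.
apply: (@is_derive1_comp _ g (fun s => F (s *: v + w))); last exact: is_derive_line0.
by rewrite scale0r add0r.
Qed.

Lemma line_MVT F F' w v (h : R) :
  (forall s, `|s| <= `|h| -> is_derive (s *: v + w) v F (F' (s *: v + w))) ->
  exists2 s, `|s| <= `|h| & F (h *: v + w) - F w = h * F' (s *: v + w).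
Proof.
move=> dF.
have D (s : R) : `|s| <= `|h| -> is_derive s 1 (fun s : R => F (s *: v + w)) (F' (s *: v + w)).
  by move=> /dF /is_derive_lineP.
have C (a b : R) : (forall s, s \in `[a, b]%R -> `|s| <= `|h|) ->
    {within `[a, b], continuous (fun s : R => F (s *: v + w))}.
  by move=> ab; apply: derivable_within_continuous => s /ab/D[].
have [h0|h0] := leP 0 h.
  have I s : s \in `[0, h]%R -> `|s| <= `|h|.
    by rewrite in_itv/= => /andP[s0 sh]; rewrite !ger0_norm.
  have [s sI] := MVT_segment h0 (fun s sI => D s (I s (subset_itv_oo_cc sI))) (C _ _ I).
  rewrite scale0r add0r subr0 mulrC => E.
  by exists s; [exact: I|].
have I s : s \in `[h, 0]%R -> `|s| <= `|h|.
  by rewrite in_itv/= => /andP[s0 sh]; rewrite !ler0_norm ?lerN2// ltW.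
have [s sI] := MVT_segment (ltW h0) (fun s sI => D s (I s (subset_itv_oo_cc sI))) (C _ _ I).
rewrite scale0r add0r sub0r mulrN => E.
by exists s; [exact: I|rewrite -[LHS]opprB E opprK mulrC].
Qed.

End LineDerivatives.

(** * Compactness and vanishing integrals of partial derivatives on row vectors *)

Section RowVectors.
Variables (R : realType) (m : nat).
Local Notation pt := 'rV[R]_m.

Lemma continuous_rowP (F : pt -> R) (w : pt) : {for w, continuous F} <->
  forall e, 0 < e -> exists2 d, 0 < d &
    forall y : pt, (forall i, `|w ord0 i - y ord0 i| <= d) -> `|F w - F y| <= e.
Proof.
split => [h e e0|h].
  have /cvgrPdist_le/(_ _ e0) : F x @[x --> w] --> F w by [].
  move/nbhs_ballP => -[d d0 wd]; exists (d / 2); first by rewrite divr_gt0.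
  move=> y wy; apply: wd; split => // i j; rewrite !ord1.
  by rewrite /ball/= (le_lt_trans (wy j))// ltr_pdivrMr// ltr_pMr// ltr1n.
have L : forall e, 0 < e -> \forall y \near w, `|F w - F y| <= e.
  move=> e /h[d d0 wd]; apply/nbhs_ballP; exists d => // y [_ wy].
  by apply: wd => i; exact/ltW/wy.
by move/cvgrPdist_le : L.
Qed.

Lemma ucc_continuous (F : pt -> R) : continuous F ->
  (forall w : pt, (exists i, 1 < `|w ord0 i|) -> F w = 0) ->
  ucc (fun x => F (\row_j x j)).
Proof.
move=> cF sF; split => [e e0|x i xi]; last first.
  by apply: sF; exists i; rewrite mxE.
(* Heine-Cantor on an enlarged cube: with a margin of one unit and a modulus at most 1, a point
   outside it and all its neighbours lie off the support. *)
pose K : set pt := [set v | forall i, (`[-2, 2] : set R) (v ord0 i)].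
have cK : compact K.
  apply: (@rV_compact R m (fun=> `[-2, 2]%classic)) => i; exact: segment_compact.
have H := (compact_near_coveringP K).1 cK R 0^'+ (fun (d : R) (w : pt) =>
    forall y : pt, (forall i, `|w ord0 i - y ord0 i| <= d) -> `|F w - F y| <= e) _.
have e2 : 0 < e / 2 by rewrite divr_gt0.
have {}H : \forall d \near 0^'+, K `<=` (fun w : pt => forall y : pt,
    (forall i, `|w ord0 i - y ord0 i| <= d) -> `|F w - F y| <= e).
  apply: H => w _; have /continuous_rowP/(_ _ e2)[d d0 wd] := cF w.
  have d2 : 0 < d / 2 by rewrite divr_gt0.
  exists (ball w (d / 2), [set t | t < d / 2]); first split => /=.
  - exact: nbhsx_ballx.
  - exact: nbhs_right_lt.
  move=> [w' t] /= [[_ ww'] td] y w'y.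
  rewrite (splitr e) (le_trans (ler_distD (F w) _ _))// lerD//.
    by rewrite distrC; apply: wd => i; rewrite (le_trans (ltW (ww' _ _)))//; lra.
  apply: wd => i; rewrite (splitr d) (le_trans (ler_distD (w' ord0 i) _ _))// lerD//.
    exact/ltW/ww'.
  by rewrite (le_trans (w'y i))// ltW.
near (0:R)^'+ => d.
have Hd : K `<=` (fun w : pt => forall y : pt,
    (forall i, `|w ord0 i - y ord0 i| <= d) -> `|F w - F y| <= e) by near: d.
have d1 : d <= 1 by near: d; exact: nbhs_right_le.
exists d => // x y xy.
have [xK|/existsNP[i xi]] := pselect (K (\row_j x j)).
  by apply: Hd => // i; rewrite !mxE.
have x2 : 2 < `|x i|.
  by rewrite ltNge ler_norml; apply: contra_notN xi; rewrite !mxE/= in_itv.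
have y1 : 1 < `|y i|.
  have := ler_normD (x i - y i) (y i); rewrite subrK => h.
  by have := xy i; lra.
rewrite !sF ?subrr ?normr0 ?ltW//; exists i; rewrite mxE//.
by apply: lt_trans x2; rewrite ltr1n.
Unshelve. all: by end_near. Qed.

(** The mean value theorem writes the difference quotient as [F'] at a nearby point; uniform
    continuity of [F'] then gives the uniform estimate that [iintR_derive_eq0] asks for. *)
Lemma iintR_partial_eq0 (F F' : pt -> R) (k : 'I_m) :
  continuous F -> continuous F' ->
  (forall w : pt, (exists i, 1 < `|w ord0 i|) -> F w = 0) ->
  (forall w : pt, (exists i, 1 < `|w ord0 i|) -> F' w = 0) ->
  (forall w, is_derive w (delta_mx ord0 k) F (F' w)) ->
  iintR (fun x => F' (\row_j x j)) = 0.
Proof.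
move=> cF cF' sF sF' dF; have uF' := ucc_continuous cF' sF'.
apply: (@iintR_derive_eq0 _ _ k (fun x => F (\row_j x j))) => //.
  exact: ucc_continuous.
move=> e e0; have [d d0 Fd] := uF'.1 e e0; exists d => // x h hd.
have -> : \row_j shift_coord k h x j = h *: delta_mx ord0 k + \row_j x j :> pt.
  apply/rowP => j; rewrite !mxE eqxx/= /shift_coord addrC.
  by case: eqP => _; rewrite ?mulr1 ?mulr0.
have [s sh ->] := line_MVT (h := h) (fun s _ => dF (s *: delta_mx ord0 k + \row_j x j)).
rewrite -mulrBr normrM mulrC ler_wpM2r//.
have -> : s *: delta_mx ord0 k + \row_j x j = \row_j shift_coord k s x j :> pt.
  apply/rowP => j; rewrite !mxE eqxx/= /shift_coord addrC.
  by case: eqP => _; rewrite ?mulr1 ?mulr0.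
apply: Fd => i; rewrite /shift_coord addrAC subrr add0r.
by case: eqP => _; [exact: le_trans sh hd|rewrite normr0 ltW].
Qed.

Definition sqn (w : pt) : R := \sum_i w ord0 i ^+ 2.

Lemma sqn_ge0 w : 0 <= sqn w.
Proof. by apply: sumr_ge0 => i _; exact: sqr_ge0. Qed.

Lemma coord_sqn_le (w : pt) i : w ord0 i ^+ 2 <= sqn w.
Proof.
by rewrite /sqn (bigD1 i)//= lerDl sumr_ge0// => j _; exact: sqr_ge0.
Qed.

Lemma continuous_sum_ord (T : topologicalType) n (f : 'I_n -> T -> R) (x : T) :
  (forall i, {for x, continuous (f i)}) ->
  {for x, continuous (fun y => \sum_(i < n) f i y)}.
Proof.
elim: n f => [|n IH] f cf.
  have -> : (fun y => \sum_(i < 0) f i y) = fun=> 0.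
    by apply/funext => y; rewrite big_ord0.
  exact: cst_continuous.
have -> : (fun y => \sum_(i < n.+1) f i y) =
    (fun y => f ord0 y + \sum_(i < n) f (lift ord0 i) y).
  by apply/funext => y; rewrite big_ord_recl.
by apply: continuousD; [exact: cf|apply: IH => i; exact: cf].
Qed.

Lemma continuous_sqnB (z : pt) : continuous (fun w : pt => sqn (w - z)).
Proof.
move=> w; apply: continuous_sum_ord => i.
have c : {for w, continuous (fun w : pt => (w - z) ord0 i)}.
  apply: (@continuous_comp _ _ _ (fun w : pt => w - z) (fun M : pt => M ord0 i)).
    by apply: continuousB; [exact: cvg_id|exact: cst_continuous].
  exact: coord_continuous.
by apply: (continuousM c c).
Qed.

Lemma is_derive_coord (w v : pt) i : is_derive w v (fun w : pt => w ord0 i) (v ord0 i).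
Proof.
apply: is_derive_of_line0.
have -> : (fun s : R => (s *: v + w) ord0 i) = fun s => s * v ord0 i + w ord0 i.
  by apply/funext => s; rewrite !mxE.
apply: (is_derive_eq (is_derive_add (is_derive_mul (is_derive_id _ _)
  (is_derive_cst _ _ _)) (is_derive_cst _ _ _))).
by rewrite mulr0 !addr0 mul1r.
Qed.

Lemma is_derive_sqnB (z w : pt) k :
  is_derive w (delta_mx ord0 k) (fun w : pt => sqn (w - z)) (2 * (w ord0 k - z ord0 k)).
Proof.
refine (is_derive_eq _ _).
  apply: (@is_derive_sum_ord _ _ _ (fun i (w : pt) => (w - z) ord0 i ^+ 2)) => i.
  apply: is_derive_sqr.
  have -> : (fun w : pt => (w - z) ord0 i) = fun w => w ord0 i + - z ord0 i.
    by apply/funext => y; rewrite !mxE.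
  exact: (is_derive_add (is_derive_coord _ _ _) (is_derive_cst _ _ _)).
rewrite (bigD1 k)//= big1 ?addr0; last first.
  by move=> i ik; rewrite !mxE (negbTE ik) andbF ?addr0 /= !mulr0.
by rewrite !mxE !eqxx mulr1.
Qed.

End RowVectors.

(** * Integration by parts against truncated paraboloids *)

Section Geometry.
Variables (R : realType) (n : nat).
Local Notation pt := 'rV[R]_(n + n).
Implicit Types w z : pt.

Lemma enormE w : enorm w = Num.sqrt (sqn w).
Proof. by rewrite /enorm /sqn big_split_ord/= -big_split. Qed.

Lemma enorm_ge0 w : 0 <= enorm w.
Proof. by rewrite enormE sqrtr_ge0. Qed.

Lemma enorm_sqr w : enorm w ^+ 2 = sqn w.
Proof. by rewrite enormE sqr_sqrtr// sqn_ge0. Qed.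

Lemma coord_enorm_le w i : `|w ord0 i| <= enorm w.
Proof. by rewrite enormE -sqrtr_sqr ler_wsqrtr// coord_sqn_le. Qed.

Lemma continuous_enorm : continuous (@enorm R n).
Proof.
have -> : @enorm R n = fun w => Num.sqrt (sqn (w - 0)).
  by apply/funext => w; rewrite subr0 enormE.
move=> w; apply: (@continuous_comp _ _ _ (fun w => sqn (w - 0)) Num.sqrt).
  exact: continuous_sqnB.
exact: sqrt_continuous.
Qed.

(** Cauchy-Schwarz, from the sum of the squares of |z| w_i - |w| z_i, which equals 2 |w| |z| (|w|
    |z| - <w, z>). Null vectors are treated apart because the factor |w| |z| is cancelled. *)
Lemma sum_mul_le_enorm w z : \sum_i w ord0 i * z ord0 i <= enorm w * enorm z.
Proof.
have [w0|w0] := eqVneq (enorm w) 0.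
  rewrite w0 mul0r big1// => i _.
  have := coord_enorm_le w i; rewrite w0 normr_le0 => /eqP ->.
  by rewrite mul0r.
have [z0|z0] := eqVneq (enorm z) 0.
  rewrite z0 mulr0 big1// => i _.
  have := coord_enorm_le z i; rewrite z0 normr_le0 => /eqP ->.
  by rewrite mulr0.
have w1 : 0 < enorm w by rewrite lt_def w0 enorm_ge0.
have z1 : 0 < enorm z by rewrite lt_def z0 enorm_ge0.
have : 0 <= \sum_i (enorm z * w ord0 i - enorm w * z ord0 i) ^+ 2.
  by apply: sumr_ge0 => i _; exact: sqr_ge0.
have -> : \sum_i (enorm z * w ord0 i - enorm w * z ord0 i) ^+ 2 =
    enorm z ^+ 2 * sqn w + enorm w ^+ 2 * sqn z
      - 2 * (enorm w * enorm z) * \sum_i w ord0 i * z ord0 i.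
  rewrite /sqn !mulr_sumr -big_split -sumrB/=; apply: eq_bigr => i _; ring.
rewrite -!enorm_sqr.
set S := \sum_i _; move=> h.
have {}h : 0 <= 2 * (enorm w * enorm z) * (enorm w * enorm z - S).
  by apply: le_trans h _; rewrite le_eqVlt; apply/orP; left; apply/eqP; ring.
by move: h; rewrite pmulr_rge0 ?subr_ge0// !mulr_gt0.
Qed.

Lemma enormD w z : enorm (w + z) <= enorm w + enorm z.
Proof.
rewrite -(@ler_pXn2r _ 2) ?nnegrE ?addr_ge0 ?enorm_ge0//.
rewrite sqrrD !enorm_sqr.
have -> : sqn (w + z) = sqn w + (\sum_i w ord0 i * z ord0 i) *+ 2 + sqn z.
  rewrite /sqn -sumrMnl -!big_split/=; apply: eq_bigr => i _.
  by rewrite !mxE sqrrD.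
by rewrite lerD2r lerD2l ler_wMn2r// sum_mul_le_enorm.
Qed.

Lemma ball_out w : (exists i, 1 < `|w ord0 i|) -> ~ ball_n w.
Proof.
move=> [i wi] wB; have := le_lt_trans (coord_enorm_le w i) wB.
by rewrite ltNge ltW.
Qed.

Lemma near_ball_n w : ball_n w -> \forall y \near w, ball_n y.
Proof.
move=> wB; have c : enorm y @[y --> w] --> enorm w by exact: continuous_enorm.
exact: (cvgr_lt _ c _ wB).
Qed.

End Geometry.

Section Bump.
Variables (R : realType) (n : nat).
Local Notation pt := 'rV[R]_(n + n).
Implicit Types (w z : pt) (F : pt -> R).

(** Here [s] is a squared radius. At [k] = 0 the value is 1 everywhere, which is why the support
    lemmas are stated for [k.+1]; differentiation lowers the exponent by one, hence [k.+2] in the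
    lemmas about derivatives. *)
Definition pbump z (s : R) k w := Num.max 0 (s - sqn (w - z)) ^+ k.

Definition rowint (F : pt -> R) : R := iintR (fun x => F (\row_j x j)).

Definition sub_ball z (s : R) := forall w, sqn (w - z) <= s -> ball_n w.

Definition cont_ball F := forall w, ball_n w -> {for w, continuous F}.

Lemma bump_ge0 z s k w : 0 <= pbump z s k w.
Proof. by rewrite exprn_ge0// le_max lexx. Qed.

Lemma bump_eq0 z s k w : s <= sqn (w - z) -> pbump z s k.+1 w = 0.
Proof. by move=> h; rewrite /pbump max_l ?expr0n// subr_le0. Qed.

Lemma near_bump_eq0 z s k w : s < sqn (w - z) ->
  \forall y \near w, pbump z s k.+1 y = 0.
Proof.
move=> h; have : \forall y \near w, s < sqn (y - z).
  have c : sqn (y - z) @[y --> w] --> sqn (w - z) by exact: continuous_sqnB.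
  exact: (cvgr_gt _ c _ h).
by apply: filterS => y ys; rewrite bump_eq0// ltW.
Qed.

Lemma continuous_bump z s k : continuous (pbump z s k).
Proof.
move=> w; rewrite /pbump.
have c : {for w, continuous (fun w => Num.max 0 (s - sqn (w - z)))}.
  have c0 : {for w, continuous (fun _ : pt => 0 : R)} by exact: cst_continuous.
  have c1 : {for w, continuous (fun w => s - sqn (w - z))}.
    by apply: continuousB; [exact: cst_continuous|exact: continuous_sqnB].
  exact: (continuous_max c0 c1).
elim: k => [|k IH]; first by exact: cst_continuous.
have -> : (fun w => Num.max 0 (s - sqn (w - z)) ^+ k.+1) =
    (fun w => Num.max 0 (s - sqn (w - z)) * Num.max 0 (s - sqn (w - z)) ^+ k).
  by apply/funext => y; rewrite exprS.
exact: (continuousM c IH).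
Qed.

Lemma continuous_mul_bump F z s k : sub_ball z s -> cont_ball F ->
  continuous (fun w => F w * pbump z s k.+1 w).
Proof.
move=> sb cF w; have [ws|ws] := leP (sqn (w - z)) s.
  by apply: continuousM; [exact/cF/sb|exact: continuous_bump].
apply: (@near_cst_continuous _ _ 0).
by near=> y; rewrite (_ : pbump _ _ _ _ = 0) ?mulr0//; near: y; exact: near_bump_eq0.
Unshelve. all: by end_near. Qed.

Lemma mul_bump_out F z s k : sub_ball z s ->
  forall w, (exists i, 1 < `|w ord0 i|) -> F w * pbump z s k.+1 w = 0.
Proof.
move=> sb w /ball_out wB; rewrite bump_eq0 ?mulr0//.
by rewrite leNgt; apply/negP => /ltW /sb.
Qed.

Lemma ucc_mul_bump F z s k : sub_ball z s -> cont_ball F ->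
  ucc (fun x => (fun w => F w * pbump z s k.+1 w) (\row_j x j)).
Proof.
by move=> sb cF; apply: ucc_continuous;
  [exact: continuous_mul_bump|exact: mul_bump_out].
Qed.

Lemma is_derive_maxX k (x : R) :
  is_derive x 1 (fun x => Num.max 0 x ^+ k.+2) (k.+2%:R * Num.max 0 x ^+ k.+1).
Proof.
have [x0|x0|->] := ltgtP x 0.
- apply: (@near_eq_is_derive _ _ _ (fun=> 0)).
    near=> y; rewrite /= max_l ?expr0n//; near: y.
    by apply: filterS (lt_nbhsl x0) => y /ltW.
  by rewrite expr0n/= mulr0; exact: is_derive_cst.
- refine (@near_eq_is_derive R R R (fun x => x ^+ k.+2) _ _ _ _ _ _).
    near=> y; rewrite /= max_r//; near: y.
    by apply: filterS (lt_nbhsr x0) => y /ltW.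
  have := is_deriveX k.+2 (is_derive_id x (1 : R)).
  by rewrite exprfctE [_ *: 1]mulr1.
(* At the kink the difference quotient is at most |h|^(k+1), hence at most |h| once |h| <= 1. *)
- rewrite ?maxxx expr0n/= mulr0.
  suff L : (fun h : R => h^-1 *: (Num.max (0 : R) (h *: (1 : R) + (0 : R) : R) ^+ k.+2 - Num.max (0 : R) 0 ^+ k.+2))
      @ 0^' --> (0 : R).
    by split; [apply/cvg_ex; exists 0|apply/cvg_lim].
  apply/cvgrPdist_le => e e0; near=> h.
  have h0 : h != 0 by near: h; exact: nbhs_dnbhs_neq.
  have he : `|h| <= e by near: h; exact: dnbhs0_le.
  have h1 : `|h| <= 1 by near: h; exact: dnbhs0_le.
  rewrite [_ *: 1]mulr1 addr0 maxxx expr0n/= subr0 sub0r normrN.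
  rewrite normrM normfV -(@ler_pM2l _ `|h|) ?normr_gt0// mulVKf ?normr_eq0//.
  have m1 : Num.max 0 h <= `|h| by rewrite ge_max normr_ge0 ler_norm.
  have m0 : 0 <= Num.max 0 h by rewrite le_max lexx.
  rewrite ger0_norm ?exprn_ge0// exprS ler_pM ?exprn_ge0//.
  rewrite exprSr (le_trans _ (le_trans m1 he))// ler_piMl// exprn_ile1//.
  exact: le_trans h1.
Unshelve. all: by end_near. Qed.

Lemma is_derive_bump z s k w (i : 'I_(n + n)) :
  is_derive w (delta_mx ord0 i) (pbump z s k.+2)
    (- (2 * k.+2%:R) * ((w ord0 i - z ord0 i) * pbump z s k.+1 w)).
Proof.
have h : is_derive w (delta_mx ord0 i) (fun w => s - sqn (w - z))
    (0 - 2 * (w ord0 i - z ord0 i)).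
  exact: (is_deriveB (is_derive_cst _ _ _) (is_derive_sqnB z w i)).
apply: (is_derive_eq (is_derive_comp1 (is_derive_maxX k _) h)).
by rewrite /pbump; ring.
Qed.

(** The product of [F] and the bump, extended by zero, has a continuous partial derivative supported
    in the ball, whose integral is zero; the derivative of the bump supplies the factor -2 (k + 2)
    (w_i - z_i). *)
Lemma rowint_byparts F F' z s k (i : 'I_(n + n)) : sub_ball z s ->
  cont_ball F -> cont_ball F' ->
  (forall w, ball_n w -> is_derive w (delta_mx ord0 i) F (F' w)) ->
  rowint (fun w => F' w * pbump z s k.+2 w) =
  2 * k.+2%:R * rowint (fun w => (w ord0 i - z ord0 i) * F w * pbump z s k.+1 w).
Proof.
move=> sb cF cF' dF.
have cG : cont_ball (fun w => (w ord0 i - z ord0 i) * F w).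
  move=> w wB; apply: continuousM; last exact: cF.
  by apply: continuousB; [exact: coord_continuous|exact: cst_continuous].
pose D w := - (2 * k.+2%:R) * ((w ord0 i - z ord0 i) * F w * pbump z s k.+1 w)
  + F' w * pbump z s k.+2 w.
have : rowint D = 0.
  apply: (@iintR_partial_eq0 _ _ (fun w => F w * pbump z s k.+2 w) _ i).
  - exact: continuous_mul_bump.
  - move=> w; apply: (@continuousD _ _ _ (fun w => - (2 * k.+2%:R) *
      ((w ord0 i - z ord0 i) * F w * pbump z s k.+1 w))
      (fun w => F' w * pbump z s k.+2 w)); last exact: continuous_mul_bump.
    by apply: continuousM; [exact: cst_continuous|exact: continuous_mul_bump].
  - exact: mul_bump_out.
  - move=> w wo; rewrite /D mul_bump_out// (@mul_bump_out (fun w => _ * F w))//.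
    by rewrite mulr0 addr0.
  (* The sphere |w - z|^2 = [s] goes with the inside, where [sub_ball] still provides the derivative
     of [F]; strictly outside, the product vanishes in a neighbourhood. *)
  - move=> w; have [ws|ws] := leP (sqn (w - z)) s.
      apply: (is_derive_eq (is_derive_mul (dF _ (sb _ ws)) (is_derive_bump z s k w i))).
      by rewrite /D; ring.
    apply: (@near_eq_is_derive _ _ _ (fun=> 0)).
      near=> y; rewrite (_ : pbump _ _ _ _ = 0) ?mulr0//; near: y.
      exact: near_bump_eq0.
    rewrite /D !bump_eq0 ?ltW// !mulr0 addr0; exact: is_derive_cst.
rewrite /rowint /D iintR_lin; first by move=> h; lra.
- exact: (@ucc_mul_bump (fun w => (w ord0 i - z ord0 i) * F w)).
- exact: ucc_mul_bump.
Unshelve. all: by end_near. Qed.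

End Bump.

(** * Mean value inequality for subharmonic functions *)

Section SubMean.
Variables (R : realType) (n : nat).
Local Notation pt := 'rV[R]_(n + n).
Implicit Types (w z : pt) (F : pt -> R).

Lemma sub_ball_le z (s t : R) : t <= s -> sub_ball z s -> sub_ball z t.
Proof. by move=> ts sb w wt; apply: sb; exact: le_trans wt ts. Qed.

Lemma cont_ball_norm F : cont_ball F -> cont_ball (fun w => `|F w|).
Proof.
move=> cF w wB; apply: (@continuous_comp _ _ _ F (fun x => `|x|)).
  exact: cF.
exact: norm_continuous.
Qed.

Lemma norm_rowint_le F G : ucc (fun x => F (\row_j x j)) ->
  ucc (fun x => G (\row_j x j)) -> (forall w, `|F w| <= G w) ->
  `|rowint F| <= rowint G.
Proof.
move=> uF uG FG; rewrite ler_norml; apply/andP; split.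
  have -> : - rowint G = iintR (fun x => -1 * G (\row_j x j)).
    by rewrite iintR_scale// mulN1r.
  apply: le_iintR => // [|x]; first exact: ucc_scale.
  by rewrite mulN1r; have := FG (\row_j x j); rewrite ler_norml => /andP[].
apply: le_iintR => // x.
by have := FG (\row_j x j); rewrite ler_norml => /andP[].
Qed.

Lemma bump2_taylor z t h w :
  `|pbump z (t + h) 2 w - pbump z t 2 w - 2 * h * pbump z t 1 w| <= h ^+ 2.
Proof.
rewrite /pbump !expr1 !maxEle.
have -> : t + h - sqn (w - z) = (t - sqn (w - z)) + h by ring.
set a := t - _; case: ifP => h1; case: ifP => h2;
  rewrite ler_norml; apply/andP; split; nra.
Qed.

(** Differentiation under the integral. The Taylor error is at most |F| h^2 and lives where |w -
    z|^2 < t + c; there the bump with parameter [s] is at least [c], so |F| times that bump, divided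
    by [c], is a majorant that stays in [ucc]. *)
Lemma is_derive_rowint_bump F z s (t : R) : sub_ball z s -> cont_ball F ->
  0 < t < s ->
  is_derive t 1 (fun t => rowint (fun w => F w * pbump z t 2 w))
    (2 * rowint (fun w => F w * pbump z t 1 w)).
Proof.
move=> sb cF /andP[t0 ts].
pose E t := rowint (fun w => F w * pbump z t 2 w).
pose K := rowint (fun w => `|F w| * pbump z s 1 w).
pose c := (s - t) / 2.
have c0 : 0 < c by rewrite divr_gt0// subr_gt0.
have sbt h : `|h| <= c -> sub_ball z (t + h).
  move=> hc; apply: sub_ball_le sb; have := ler_norm h.
  by move: hc; rewrite /c; lra.
have sb0 : sub_ball z t by apply: sub_ball_le sb; exact: ltW.
have bound h : `|h| <= c ->
    `|E (t + h) - E t - h * (2 * rowint (fun w => F w * pbump z t 1 w))|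
      <= h ^+ 2 * (c^-1 * K).
  move=> hc; have sbh := sbt h hc.
  have u1 := ucc_mul_bump 1 sbh cF.
  have u2 := ucc_mul_bump 1 sb0 cF.
  have u3 := ucc_mul_bump 0 sb0 cF.
  have u4 := ucc_mul_bump 0 sb (cont_ball_norm cF).
  have -> : E (t + h) - E t - h * (2 * rowint (fun w => F w * pbump z t 1 w)) =
      rowint (fun w => (-1 * (F w * pbump z t 2 w) +
        (- (2 * h) * (F w * pbump z t 1 w) + F w * pbump z (t + h) 2 w))).
    rewrite /rowint iintR_lin ?iintR_lin//; last exact: ucc_lin.
    by rewrite /E /rowint; ring.
  have -> : h ^+ 2 * (c^-1 * K) =
      rowint (fun w => h ^+ 2 / c * (`|F w| * pbump z s 1 w)).
    by rewrite /rowint iintR_scale// /K /rowint mulrA.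
  apply: norm_rowint_le => [||w].
  - exact: ucc_lin (ucc_lin _ u3 u1).
  - exact: ucc_scale.
  have -> : -1 * (F w * pbump z t 2 w) +
      (- (2 * h) * (F w * pbump z t 1 w) + F w * pbump z (t + h) 2 w) =
      F w * (pbump z (t + h) 2 w - pbump z t 2 w - 2 * h * pbump z t 1 w) by ring.
  rewrite normrM [leRHS]mulrCA ler_wpM2l//.
  have [ws|ws] := leP (t + c) (sqn (w - z)).
    have hn := ler_norm h.
    have wt : t <= sqn (w - z) by lra.
    have wth : t + h <= sqn (w - z) by lra.
    rewrite !(bump_eq0 _ wth) !(bump_eq0 _ wt) mulr0 !subr0 normr0.
    by rewrite mulr_ge0 ?bump_ge0// divr_ge0 ?sqr_ge0// ltW.
  apply: le_trans (bump2_taylor _ _ _ _) _.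
  rewrite -mulrA ler_peMr ?sqr_ge0// mulrC ler_pdivlMr// mul1r.
  by rewrite /pbump expr1 le_max; apply/orP; right; move: ws; rewrite /c; lra.
suff L : (fun h => h^-1 *: (E (h *: 1 + t) - E t)) @ 0^' -->
    2 * rowint (fun w => F w * pbump z t 1 w).
  split; first by apply/cvg_ex; eexists; exact: L.
  by apply/cvg_lim.
have K1 : 0 < `|c^-1 * K| + 1 by rewrite ltr_wpDl.
apply/cvgrPdist_le => e e0; near=> h.
have h0 : h != 0 by near: h; exact: nbhs_dnbhs_neq.
have hc : `|h| <= c by near: h; exact: dnbhs0_le.
have he : `|h| <= e / (`|c^-1 * K| + 1).
  by near: h; apply: dnbhs0_le; exact: divr_gt0.
rewrite distrC -(@ler_pM2l _ `|h|) ?normr_gt0// -normrM mulrBr.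
rewrite [_ *: 1]mulr1 /GRing.scale/= mulVKf// [h + t]addrC.
apply: le_trans (bound h hc) _.
rewrite -real_normK ?num_real// expr2 -mulrA ler_wpM2l//.
move: he; rewrite ler_pdivlMr// => /(le_trans _); apply.
by rewrite ler_wpM2l// (le_trans (ler_norm _))// lerDl.
Unshelve. all: by end_near. Qed.

Section Subharmonic.
Variables (g : pt -> R) (gk gkk : 'I_(n + n) -> pt -> R).
Hypotheses (cg : cont_ball g) (cgk : forall k, cont_ball (gk k))
  (cgkk : forall k, cont_ball (gkk k)).
Hypothesis dg : forall k w, ball_n w -> is_derive w (delta_mx ord0 k) g (gk k w).
Hypothesis dgk : forall k w, ball_n w ->
  is_derive w (delta_mx ord0 k) (gk k) (gkk k w).
Hypothesis subh : forall w, ball_n w -> 0 <= \sum_k gkk k w.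

(* Divergence identity for the fields [(w - z) g b^2] and [grad g b^3], where
   [b] is the positive part of [t - |w - z|^2]. *)
Lemma rowint_bump_growth z t : sub_ball z t ->
  (n.+2)%:R * rowint (fun w => g w * pbump z t 2 w) <=
  t * (2 * rowint (fun w => g w * pbump z t 1 w)).
Proof.
move=> sb.
have ccoord k : cont_ball (fun w => w ord0 k - z ord0 k).
  move=> w wB; apply: continuousB; last exact: cst_continuous.
  exact: coord_continuous.
pose E := rowint (fun w => g w * pbump z t 2 w).
pose A k := rowint (fun w => (w ord0 k - z ord0 k) * gk k w * pbump z t 2 w).
pose B k := rowint (fun w => (w ord0 k - z ord0 k) *
  ((w ord0 k - z ord0 k) * g w) * pbump z t 1 w).
have cA k : cont_ball (fun w => (w ord0 k - z ord0 k) * gk k w).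
  by move=> w wB; apply: continuousM; [exact: ccoord|exact: cgk].
have cB k : cont_ball (fun w => (w ord0 k - z ord0 k) *
    ((w ord0 k - z ord0 k) * g w)).
  move=> w wB; apply: continuousM; first exact: ccoord.
  by apply: continuousM; [exact: ccoord|exact: cg].
(* Integrating [gkk k] by parts against b^3 brings out the factor 2 * 3 = 6. Subharmonicity enters
   here. *)
have A_ge0 : 0 <= \sum_k A k.
  have h k : A k = 6^-1 * rowint (fun w => gkk k w * pbump z t 3 w).
    by rewrite (rowint_byparts 1 sb (@cgk k) (@cgkk k) (@dgk k)) /A; field.
  rewrite (eq_bigr _ (fun k _ => h k)) -mulr_sumr mulr_ge0// /rowint.
  rewrite -iintR_sum; last by move=> k; exact: ucc_mul_bump.
  rewrite -[leLHS](iintR0 R (n + n)); apply: le_iintR => [||x]; first exact: ucc0.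
    apply: (@ucc_sum _ _ _ _ (fun k x => gkk k (\row_j x j) * pbump z t 3 (\row_j x j))).
    by move=> k; exact: ucc_mul_bump.
  rewrite -mulr_suml; have [ws|ws] := leP (sqn (\row_j x j - z)) t.
    by rewrite mulr_ge0 ?bump_ge0// subh//; exact: sb.
  by rewrite bump_eq0 ?mulr0// ltW.
(* Integration by parts of (w_k - z_k) g against b^2; the factor 4 is 2 * 2. *)
have EAB k : E + A k = 4 * B k.
  have <- : rowint (fun w => (g w + (w ord0 k - z ord0 k) * gk k w) * pbump z t 2 w) =
      4 * B k.
    have -> : 4 = 2 * 2%:R :> R by ring.
    apply: (@rowint_byparts _ _ (fun w => (w ord0 k - z ord0 k) * g w)) => //.
    - by move=> w wB; apply: continuousM; [exact: ccoord|exact: cg].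
    - by move=> w wB; apply: continuousD; [exact: cg|exact: cA].
    - move=> w wB.
      have hc : is_derive w (delta_mx ord0 k) (fun w => w ord0 k - z ord0 k) 1.
        have := is_deriveB (is_derive_coord w (delta_mx ord0 k) k)
          (is_derive_cst (z ord0 k) w (delta_mx ord0 k)).
        by rewrite mxE !eqxx subr0.
      by apply: (is_derive_eq (is_derive_mul hc (dg k wB))); rewrite mul1r.
  rewrite /E /A /rowint -iintR_add; [|exact: ucc_mul_bump|exact: (ucc_mul_bump 1 sb (@cA k))].
  by congr iintR; apply/funext => x; ring.
(* The squares (w_k - z_k)^2 add up to |w - z|^2, and |w - z|^2 b = t b - b^2. *)
have SB : \sum_k B k = t * rowint (fun w => g w * pbump z t 1 w) - E.
  rewrite /B /E /rowint -iintR_sum; last by move=> k; exact: (ucc_mul_bump 0 sb (@cB k)).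
  have u1 := ucc_mul_bump 0 sb cg; have u2 := ucc_mul_bump 1 sb cg.
  rewrite -[X in _ = _ - X]mul1r -mulNr -[X in _ = _ + X]iintR_scale//.
  rewrite -[RHS]iintR_lin//; last exact: ucc_scale.
  congr iintR; apply/funext => x; set w := \row_j x j.
  rewrite -mulr_suml.
  have -> : \sum_k (w ord0 k - z ord0 k) * ((w ord0 k - z ord0 k) * g w) =
      sqn (w - z) * g w.
    rewrite /sqn mulr_suml; apply: eq_bigr => k _.
    by rewrite !mxE expr2 mulrA.
  have -> : pbump z t 2 w = (t - sqn (w - z)) * pbump z t 1 w.
    rewrite /pbump !expr1 expr2 maxEle; case: ifP => // _.
    by rewrite !mulr0.
  by ring.
(* Over the 2n coordinates, 2n E + sum A = 4 (t I - E) with I the integral of g b; dropping sum A >=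
   0 and halving gives the factor n + 2. *)
have : \sum_k (E + A k) = \sum_k 4 * B k by apply: eq_bigr => k _.
rewrite big_split/= sumr_const card_ord -mulr_sumr SB -/E => h.
have : E *+ (n + n) = 2 * n%:R * E by rewrite mulrnDr -mulr_natl; ring.
have : (n.+2)%:R = n%:R + 2 :> R by rewrite -addn2 natrD.
by move=> -> h2; nra.
Qed.

(** The derivative of t^-(n+2) E(t) is t^-(n+3) (t E'(t) - (n+2) E(t)). Only a sign is carried from
    [t1] to [t2], so no limit at 0 and no normalising constant have to be computed. *)
Lemma rowint_bump_ge0 z s t1 t2 : sub_ball z s -> 0 < t1 -> t1 <= t2 -> t2 < s ->
  0 <= rowint (fun w => g w * pbump z t1 2 w) ->
  0 <= rowint (fun w => g w * pbump z t2 2 w).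
Proof.
move=> sb t10 t12 t2s E1.
pose E t := rowint (fun w => g w * pbump z t 2 w).
pose N : R := (n.+2)%:R.
pose Phi t := t `^ (- N) * E t.
pose Phi' t := - N * t `^ (- N - 1) * E t +
  t `^ (- N) * (2 * rowint (fun w => g w * pbump z t 1 w)).
have dPhi t : 0 < t < s -> is_derive t 1 Phi (Phi' t).
  move=> ts; have /andP[t0 _] := ts.
  exact: is_derive_mul (is_derive1_powR (- N) t0) (is_derive_rowint_bump sb cg ts).
have int t : t \in `[t1, t2]%R -> 0 < t < s.
  by rewrite in_itv/= => /andP[h1 h2]; rewrite (lt_le_trans t10)//= (le_lt_trans h2).
have [t tI E12] : exists2 t, t \in `[t1, t2]%R &
    Phi t2 - Phi t1 = Phi' t * (t2 - t1).
  apply: MVT_segment => // [t /subset_itv_oo_cc /int|]; first exact: dPhi.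
  by apply: derivable_within_continuous => t /int /dPhi[].
have /andP[t0 ts] := int t tI.
have P0 : 0 <= Phi' t.
  have tpow : t `^ (- N) = t * t `^ (- N - 1).
    rewrite -{2}(powRr1 (ltW t0)) -powRD ?(gt_eqF t0) ?implybT//.
    by congr powR; ring.
  rewrite /Phi' tpow.
  have -> : - N * t `^ (- N - 1) * E t +
     t * t `^ (- N - 1) * (2 * rowint (fun w => g w * pbump z t 1 w)) =
     t `^ (- N - 1) * (t * (2 * rowint (fun w => g w * pbump z t 1 w)) - N * E t).
    by ring.
  rewrite mulr_ge0 ?powR_ge0// subr_ge0; apply: rowint_bump_growth.
  by apply: sub_ball_le sb; exact: ltW.
have : 0 <= Phi t2.
  rewrite -(subrK (Phi t1) (Phi t2)) E12 addr_ge0// mulr_ge0 ?powR_ge0//.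
  by rewrite subr_ge0.
by rewrite /Phi pmulr_rge0// powR_gt0// (lt_le_trans t10).
Qed.

End Subharmonic.

(** Sign propagation is applied to g - g(z) + eta, which is nonnegative near z by continuity; then
    eta tends to 0. Adding a constant leaves [gk] and [gkk] unchanged. *)
Lemma subharmonic_mean (g : pt -> R) (gk gkk : 'I_(n + n) -> pt -> R) z s t :
  cont_ball g -> (forall k, cont_ball (gk k)) -> (forall k, cont_ball (gkk k)) ->
  (forall k w, ball_n w -> is_derive w (delta_mx ord0 k) g (gk k w)) ->
  (forall k w, ball_n w -> is_derive w (delta_mx ord0 k) (gk k) (gkk k w)) ->
  (forall w, ball_n w -> 0 <= \sum_k gkk k w) ->
  sub_ball z s -> 0 < t < s ->
  g z * rowint (pbump z t 2) <= rowint (fun w => g w * pbump z t 2 w).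
Proof.
move=> cg cgk cgkk dg dgk subh sb /andP[t0 ts].
have sbt : sub_ball z t by apply: sub_ball_le sb; exact: ltW.
have zB : ball_n z.
  apply: sbt; rewrite subrr (_ : sqn 0 = 0) ?ltW// /sqn big1// => i _.
  by rewrite mxE expr0n.
have c1 : cont_ball (fun _ : pt => 1) by move=> w _; exact: cst_continuous.
have u1 : ucc (fun x => pbump z t 2 (\row_j x j)).
  have := ucc_mul_bump 1 sbt c1.
  by congr ucc; apply/funext => x; rewrite mul1r.
have u2 := ucc_mul_bump 1 sbt cg.
have b0 : 0 <= rowint (pbump z t 2).
  rewrite -[leLHS](iintR0 R (n + n)); apply: le_iintR u1 _ => [|x]; first exact: ucc0.
  exact: bump_ge0.
have step eta : 0 < eta -> g z * rowint (pbump z t 2) <=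
    rowint (fun w => g w * pbump z t 2 w) + eta * rowint (pbump z t 2).
  move=> eta0; pose l w := g w + (eta - g z).
  have cl : cont_ball l.
    by move=> w wB; apply: continuousD; [exact: cg|exact: cst_continuous].
  have /continuous_rowP/(_ _ eta0)[d d0 gd] := cg z zB.
  (* [t1] is a squared radius, whence d^2: each coordinate then moves by at most d. *)
  pose t1 := Num.min (d ^+ 2) t.
  have t10 : 0 < t1 by rewrite lt_min exprn_gt0.
  have t1t : t1 <= t by rewrite ge_min lexx orbT.
  have : 0 <= rowint (fun w => l w * pbump z t 2 w).
    apply: (@rowint_bump_ge0 l gk gkk _ _ _ _ _ _ z s t1 t) => //.
    - move=> k w wB; have := is_deriveD (dg k w wB) (is_derive_cst (eta - g z) w _).
      by rewrite addr0.
    - rewrite -[leLHS](iintR0 R (n + n)); apply: le_iintR => [||x]; first exact: ucc0.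
        by apply: ucc_mul_bump => //; exact: sub_ball_le sbt.
      have [ws|ws] := leP t1 (sqn (\row_j x j - z)); first by rewrite bump_eq0 ?mulr0.
      rewrite mulr_ge0 ?bump_ge0// /l.
      have : `|g z - g (\row_j x j)| <= eta.
        apply: gd => i; rewrite -(@ler_pXn2r _ 2) ?nnegrE ?(ltW d0)//.
        rewrite real_normK ?num_real// -sqrrN opprB.
        have := coord_sqn_le (\row_j x j - z) i; rewrite !mxE => h.
        by apply: le_trans h (ltW (lt_le_trans ws _)); rewrite ge_min lexx.
      by rewrite ler_norml => /andP[]; lra.
  have -> : rowint (fun w => l w * pbump z t 2 w) =
      (eta - g z) * rowint (pbump z t 2) + rowint (fun w => g w * pbump z t 2 w).
    rewrite /rowint -iintR_lin//; congr iintR; apply/funext => x.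
    by rewrite /l; ring.
  by lra.
apply/ler_addgt0Pr => e e0.
have b1 : 0 < rowint (pbump z t 2) + 1 by rewrite ltr_wpDl.
apply: le_trans (step (e / (rowint (pbump z t 2) + 1)) _) _.
  exact: divr_gt0.
by rewrite lerD2l mulrAC ler_pdivrMr// ler_pM2l// lerDl.
Qed.

End SubMean.

(** * Partial derivatives of smooth functions on the ball *)

Section SmoothFunctions.
Variables (R : realType) (n : nat).
Local Notation pt := 'rV[R]_(n + n).
Implicit Types (w v : pt) (g u : pt -> R) (i j k : 'I_(n + n)).

Lemma CkR_cont m g : CkR m g -> cont_ball g.
Proof. by case: m => [|m] []. Qed.

Lemma CkR_pd m j g : CkR m.+1 g -> CkR m (pdR j g).
Proof. by case=> _ /(_ j)[]. Qed.

Lemma CkR_is_derive m j g w : CkR m.+1 g -> ball_n w ->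
  is_derive w (delta_mx ord0 j) g (pdR j g w).
Proof. by case=> _ /(_ j)[dg _] wB; split => //; exact: dg. Qed.

Lemma CkR_pred m g : CkR m.+1 g -> CkR m g.
Proof.
elim: m g => [|m IH] g [cg dg]; first by split.
split => // j; split; first exact: (dg j).1.
by apply: IH; exact: (dg j).2.
Qed.

Lemma ball_row w : ball_n w -> exists2 d, 0 < d &
  forall y : pt, (forall i, `|w ord0 i - y ord0 i| <= d) -> ball_n y.
Proof.
move=> wB; have e0 : 0 < (1 - enorm w) / 2 by rewrite divr_gt0// subr_gt0.
have /continuous_rowP/(_ _ e0)[d d0 wd] := @continuous_enorm R n w.
exists d => // y /wd; rewrite distrC => /(le_trans (ler_norm _)).
by move: wB; rewrite /ball_n/=; lra.
Qed.

Lemma near_pdR j g1 g2 w : (\forall y \near w, g1 y = g2 y) ->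
  pdR j g1 w = pdR j g2 w.
Proof. exact: near_eq_derive. Qed.

Lemma pdR_val j g w d : is_derive w (delta_mx ord0 j) g d -> pdR j g w = d.
Proof. by move=> dg; rewrite /pdR derive_val. Qed.

Lemma is_derive_shift g w v x d : is_derive (w + x) v g d ->
  is_derive w v (fun y => g (y + x)) d.
Proof.
move=> dg; apply: is_derive_of_line0.
under eq_fun do rewrite -addrA; exact: is_derive_line0.
Qed.

Definition double_diff g w i j (h : R) : R :=
  g (w + h *: delta_mx ord0 i + h *: delta_mx ord0 j)
  - g (w + h *: delta_mx ord0 i) - g (w + h *: delta_mx ord0 j) + g w.

Lemma double_diffC g w i j h : double_diff g w i j h = double_diff g w j i h.
Proof.
have E : w + h *: delta_mx ord0 i + h *: delta_mx ord0 j =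
  w + h *: delta_mx ord0 j + h *: delta_mx ord0 i by rewrite addrAC.
by rewrite /double_diff E; ring.
Qed.

(** Two mean value theorems, along i for the increment in direction j, then along j for [pdR i g],
    turn the second difference into h^2 times the mixed partial at a nearby point. The second
    difference being symmetric in i and j, [pdRC] follows. *)
Lemma double_diff_approx g w i j : CkR 2 g -> ball_n w -> forall e, 0 < e ->
  exists2 d, 0 < d & forall h, `|h| <= d ->
    `|double_diff g w i j h - h ^+ 2 * pdR j (pdR i g) w| <= h ^+ 2 * e.
Proof.
move=> g2 wB e e0.
have [d1 d10 wd1] := ball_row wB.
have c2 : cont_ball (pdR j (pdR i g)) by exact: (CkR_cont (CkR_pd j (CkR_pd i g2))).
have /continuous_rowP/(_ _ e0)[d2 d20 wd2] := c2 w wB.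
have d12 : 0 < Num.min d1 d2 by rewrite lt_min d10.
(* Half the modulus, since [i] and [j] may coincide and the two displacements then add up. *)
exists (Num.min d1 d2 / 2); first by rewrite divr_gt0.
move=> h hd.
have near_w s t : `|s| <= `|h| -> `|t| <= `|h| -> forall l,
    `|w ord0 l - (s *: delta_mx ord0 i + w + t *: delta_mx ord0 j) ord0 l|
      <= Num.min d1 d2.
  move=> sh th l; rewrite !mxE eqxx/=.
  have -> : w ord0 l - (s * (l == i)%:R + w ord0 l + t * (l == j)%:R) =
    - (s * (l == i)%:R + t * (l == j)%:R) by ring.
  rewrite normrN (le_trans (ler_normD _ _))// (splitr (Num.min d1 d2)) lerD//;
    rewrite normrM normr_nat; case: eqP => _; rewrite ?mulr1 ?mulr0.
  - exact: le_trans hd.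
  - by rewrite divr_ge0// ltW.
  - exact: le_trans hd.
  - by rewrite divr_ge0// ltW.
have inB s t : `|s| <= `|h| -> `|t| <= `|h| ->
    ball_n (s *: delta_mx ord0 i + w + t *: delta_mx ord0 j).
  move=> sh th; apply: wd1 => l; apply: le_trans (near_w s t sh th l) _.
  by rewrite ge_min lexx.
pose G y := g (y + h *: delta_mx ord0 j) + -1 * g y.
have dG s : `|s| <= `|h| -> is_derive (s *: delta_mx ord0 i + w) (delta_mx ord0 i) G
    (pdR i g (s *: delta_mx ord0 i + w + h *: delta_mx ord0 j)
     + -1 * pdR i g (s *: delta_mx ord0 i + w)).
  move=> sh; apply: is_derive_add.
    by apply: is_derive_shift; apply: CkR_is_derive g2 _; exact: inB.
  have wB' : ball_n (s *: delta_mx ord0 i + w).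
    by have := inB s 0 sh; rewrite scale0r addr0 normr0; exact.
  have := is_derive_mul (is_derive_cst (-1 : R) (s *: delta_mx ord0 i + w)
    (delta_mx ord0 i)) (CkR_is_derive i g2 wB').
  by rewrite mul0r add0r.
have [s sh Gs] := line_MVT (F' := fun y => pdR i g (y + h *: delta_mx ord0 j)
     + -1 * pdR i g y) dG.
have [t th gt] := @line_MVT _ _ (pdR i g) (pdR j (pdR i g))
  (s *: delta_mx ord0 i + w) (delta_mx ord0 j) h (fun t th =>
   CkR_is_derive j (CkR_pd i g2) (eq_ind _ _ (inB s t sh th) _ (addrC _ _))).
have -> : double_diff g w i j h = G (h *: delta_mx ord0 i + w) - G w.
  by rewrite /double_diff /G [_ + w]addrC; ring.
rewrite Gs mulN1r [_ + h *: _]addrC gt mulrA -expr2 -mulrBr normrM.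
rewrite ger0_norm ?sqr_ge0// ler_wpM2l ?sqr_ge0// distrC; apply: wd2 => l.
have := near_w s t sh th l; rewrite [_ + t *: _]addrC => /le_trans; apply.
by rewrite ge_min lexx orbT.
Qed.

Lemma dist_le_of_approx (a b D h2 e : R) : 0 < h2 ->
  `|D - h2 * a| <= h2 * (e / 2) -> `|D - h2 * b| <= h2 * (e / 2) -> `|a - b| <= e.
Proof.
move=> h0 A B; rewrite -(ler_pM2l h0) -{1}(gtr0_norm h0) -normrM.
have -> : h2 * (a - b) = (D - h2 * b) - (D - h2 * a) by ring.
rewrite (le_trans (ler_normB _ _))//.
by rewrite (_ : h2 * e = h2 * (e / 2) + h2 * (e / 2)) ?lerD//; field.
Qed.

Lemma pdRC g w i j : CkR 2 g -> ball_n w ->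
  pdR i (pdR j g) w = pdR j (pdR i g) w.
Proof.
move=> g2 wB; apply/eqP; rewrite -subr_eq0 -normr_le0; apply/ler_addgt0Pr => e e0.
rewrite add0r; have e2 : 0 < e / 2 by rewrite divr_gt0.
have [d d0 H] := double_diff_approx i j g2 wB e2.
have [d' d'0 H'] := double_diff_approx j i g2 wB e2.
pose h := Num.min d d'.
have h0 : 0 < h by rewrite lt_min d0.
have hd : `|h| <= d by rewrite gtr0_norm// ge_min lexx.
have hd' : `|h| <= d' by rewrite gtr0_norm// ge_min lexx orbT.
have := H' h hd'; rewrite double_diffC => A.
by apply: (dist_le_of_approx _ A (H h hd)); rewrite exprn_gt0.
Qed.

(** [CkR 1] provides partial derivatives only; their continuity upgrades them to a derivative in any
    direction, as radial integration requires. The increment is telescoped along a path changing one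
    coordinate at a time. *)
Lemma C1_is_derive g w v : CkR 1 g -> ball_n w ->
  is_derive w v g (\sum_k v ord0 k * pdR k g w).
Proof.
move=> g1 wB.
pose V := \sum_k `|v ord0 k| + 1.
have V0 : 0 < V by rewrite ltr_wpDl// sumr_ge0.
have vV k : `|v ord0 k| <= V.
  by rewrite /V (bigD1 k)//= -addrA lerDl addr_ge0// sumr_ge0.
suff L : (fun h => h^-1 *: (g (h *: v + w) - g w)) @ 0^' -->
    \sum_k v ord0 k * pdR k g w.
  by split; [apply/cvg_ex; eexists; exact: L|apply/cvg_lim].
apply/cvgrPdist_le => e e0.
have eV : 0 < e / V by exact: divr_gt0.
have [d1 d10 wd1] := ball_row wB.
have /choice[dk dkP] : forall k, exists d, 0 < d /\
    forall y : pt, (forall i, `|w ord0 i - y ord0 i| <= d) ->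
      `|pdR k g w - pdR k g y| <= e / V.
  move=> k; have ck : cont_ball (pdR k g) by exact: (CkR_cont (CkR_pd k g1)).
  by have /continuous_rowP/(_ _ eV)[d d0 wd] := ck w wB; exists d.
pose d := \big[Num.min/d1]_k dk k.
have d0 : 0 < d.
  by rewrite /d; elim/big_ind: _ => // [x y x0 y0|k _]; [rewrite lt_min x0|exact: (dkP k).1].
have dd1 : d <= d1 by rewrite /d; elim/big_rec: _ => // k x _ xd; rewrite ge_min xd orbT.
have ddk k : d <= dk k by exact: bigmin_le_cond.
have dV : 0 < d / V by exact: divr_gt0.
near=> h.
have h0 : h != 0 by near: h; exact: nbhs_dnbhs_neq.
have hd : `|h| <= d / V by near: h; exact: dnbhs0_le.
rewrite distrC -(@ler_pM2l _ `|h|) ?normr_gt0// -normrM mulrBr.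
rewrite /GRing.scale/= mulVKf//.
(* [vk m] keeps the first m coordinates of [v], so [vk m] and [vk m.+1] differ in coordinate m
   only. *)
pose vk (m : nat) : pt := \row_i (if (i < m)%N then v ord0 i else 0).
have vk_near (m : nat) s k : `|s| <= `|h * v ord0 k| -> (m = k) ->
   forall i, `|w ord0 i - (s *: delta_mx ord0 k + (h *: vk m + w)) ord0 i| <= d.
  move=> sh mk i; rewrite !mxE eqxx/= mk.
  have -> : forall a b c, c - (a + (b + c)) = - (a + b) :> R by move=> *; ring.
  have hV x : `|x| <= V -> `|h * x| <= d.
    move=> xV; rewrite normrM.
    apply: le_trans (ler_pM (normr_ge0 _) (normr_ge0 _) hd xV) _.
    by rewrite divfK// gt_eqF.
  rewrite normrN; case: eqP => [->|_].
    by rewrite ltnn mulr1 mulr0 addr0 (le_trans sh)// hV.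
  rewrite mulr0 add0r; case: ifP => _; first exact: hV.
  by rewrite mulr0 normr0 ltW.
have step (m : 'I_(n + n)) : `|g (h *: vk m.+1 + w) - g (h *: vk m + w)
     - h * (v ord0 m * pdR m g w)| <= `|h| * (`|v ord0 m| * (e / V)).
  have E : h *: vk m.+1 + w =
      (h * v ord0 m) *: delta_mx ord0 m + (h *: vk m + w).
    apply/rowP => i; rewrite !mxE eqxx/= ltnS leq_eqVlt (inj_eq val_inj).
    by case: eqP => [->|_]; rewrite /= ?ltnn; ring.
  have [s sh] := @line_MVT _ _ g (pdR m g) (h *: vk m + w) (delta_mx ord0 m)
     (h * v ord0 m) (fun s sh => CkR_is_derive m g1 (wd1 _ (fun i =>
       le_trans (vk_near m s m sh erefl i) dd1))).
  rewrite -E => ->; rewrite -mulrA -!mulrBr !normrM !ler_wpM2l// distrC.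
  apply: (dkP m).2 => i; apply: le_trans (ddk m).
  exact: vk_near.
have vkn : vk (n + n)%N = v by apply/rowP => i; rewrite mxE ltn_ord.
have vk0 : vk 0%N = 0 by apply/rowP => i; rewrite !mxE.
have tele : g (h *: v + w) - g w =
    \sum_(m < n + n) (g (h *: vk m.+1 + w) - g (h *: vk m + w)).
  pose G m := g (h *: vk m + w).
  rewrite -(big_mkord xpredT (fun m => G m.+1 - G m)) (@telescope_sumr _ _ _ G)//.
  by rewrite /G vkn vk0 scaler0 add0r.
rewrite tele mulr_sumr -sumrB.
apply: le_trans (ler_norm_sum _ _ _) _.
apply: le_trans (ler_sum _ (fun m _ => step m)) _.
rewrite -mulr_sumr ler_wpM2l// -mulr_suml mulrCA ler_piMr ?(ltW e0)//.
by rewrite ler_pdivrMr// mul1r lerDl.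
Unshelve. all: by end_near. Qed.

Definition laplacian g w := \sum_k pdR k (pdR k g) w.

Definition grad_sq u w := \sum_j pdR j u w ^+ 2.
Definition grad_sq1 u k w := \sum_j 2 * (pdR j u w * pdR k (pdR j u) w).
Definition grad_sq2 u k w := \sum_j 2 * (pdR k (pdR j u) w ^+ 2 +
  pdR j u w * pdR k (pdR k (pdR j u)) w).

Lemma is_derive_grad_sq u k w : CkR 2 u -> ball_n w ->
  is_derive w (delta_mx ord0 k) (grad_sq u) (grad_sq1 u k w).
Proof.
move=> u2 wB; apply: is_derive_sum_ord => j; apply: is_derive_sqr.
exact: CkR_is_derive (CkR_pd j u2) wB.
Qed.

Lemma is_derive_grad_sq1 u k w : CkR 3 u -> ball_n w ->
  is_derive w (delta_mx ord0 k) (grad_sq1 u k) (grad_sq2 u k w).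
Proof.
move=> u3 wB; apply: is_derive_sum_ord => j.
have d1 := CkR_is_derive k (CkR_pd j u3) wB.
have d2 := CkR_is_derive k (CkR_pd k (CkR_pd j u3)) wB.
apply: (is_derive_eq (is_derive_mul (is_derive_cst (2 : R) w _) (is_derive_mul d1 d2))).
by rewrite mul0r add0r expr2.
Qed.

Lemma cont_grad_sq u : CkR 1 u -> cont_ball (grad_sq u).
Proof.
move=> u1 w wB; apply: continuous_sum_ord => j.
have c : {for w, continuous (pdR j u)} by apply: (CkR_cont (CkR_pd j u1)).
exact: (continuousM c c).
Qed.

Lemma cont_grad_sq1 u k : CkR 2 u -> cont_ball (grad_sq1 u k).
Proof.
move=> u2 w wB; apply: continuous_sum_ord => j.
apply: continuousM; first exact: cst_continuous.
apply: continuousM; first exact: (CkR_cont (CkR_pd j u2)).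
exact: (CkR_cont (CkR_pd k (CkR_pd j u2))).
Qed.

Lemma cont_grad_sq2 u k : CkR 3 u -> cont_ball (grad_sq2 u k).
Proof.
move=> u3 w wB; apply: continuous_sum_ord => j.
apply: continuousM; first exact: cst_continuous.
have c : {for w, continuous (pdR k (pdR j u))}.
  exact: (CkR_cont (CkR_pd k (CkR_pd j u3))).
apply: continuousD; first exact: (continuousM c c).
apply: continuousM; first exact: (CkR_cont (CkR_pd j u3)).
exact: (CkR_cont (CkR_pd k (CkR_pd k (CkR_pd j u3)))).
Qed.

(** Bochner's formula: the Laplacian of |grad u|^2 is 2 |Hess u|^2 + 2 <grad u, grad Lap u>, and the
    Hessian term is dropped. *)
Lemma sum_grad_sq2_ge u w : CkR 3 u -> ball_n w ->
  2 * (\sum_j pdR j u w * pdR j (laplacian u) w) <= \sum_k grad_sq2 u k w.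
Proof.
move=> u3 wB.
have E j : pdR j (laplacian u) w = \sum_k pdR k (pdR k (pdR j u)) w.
  have -> : pdR j (laplacian u) w = \sum_k pdR j (pdR k (pdR k u)) w.
    apply: pdR_val; apply: is_derive_sum_ord => k.
    exact: CkR_is_derive (CkR_pd k (CkR_pd k u3)) wB.
  (* Two exchanges of partials: the outer one at w itself, the inner one as an identity near w,
     because it is differentiated once more. *)
  apply: eq_bigr => k _; rewrite (pdRC j k (CkR_pd k u3) wB).
  have N : \forall y \near w, pdR j (pdR k u) y = pdR k (pdR j u) y.
    near=> y; apply: (pdRC j k (CkR_pred u3)); near: y; exact: near_ball_n.
  exact: (near_pdR k N).
rewrite /grad_sq2 exchange_big mulr_sumr; apply: ler_sum => j _.
rewrite E mulr_sumr mulr_sumr; apply: ler_sum => k _.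
by rewrite ler_pM2l// lerDr sqr_ge0.
Unshelve. all: by end_near. Qed.

End SmoothFunctions.

(** * Real powers of functions that may vanish *)

Section PowerDerivatives.
Variable R : realType.

Lemma cvg_powR_gt0 (T : Type) (F : set_system T) (FF : Filter F) (phi : T -> R)
    (l r : R) : 0 < l ->
  phi x @[x --> F] --> l -> phi x `^ r @[x --> F] --> l `^ r.
Proof.
move=> l0 phil; apply: (@continuous_cvg _ _ _ _ FF phi (fun x => x `^ r) l) phil.
by apply: differentiable_continuous; apply/derivable1_diffP; apply: derivable_powR;
  rewrite in_itv/= l0.
Qed.

Lemma cvg_powR (T : Type) (F : set_system T) (FF : Filter F) (phi : T -> R)
    (l r : R) : (forall x, 0 <= phi x) -> 0 <= l -> 0 <= r ->
  phi x @[x --> F] --> l -> phi x `^ r @[x --> F] --> l `^ r.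
Proof.
(* Exponent 0 stands apart because the power is then constantly 1, even at base 0. *)
move=> phi0 l0 r0 phil; have [->|rn0] := eqVneq r 0.
  by rewrite powRr0; under eq_fun do rewrite powRr0; exact: cvg_cst.
move: l0; rewrite le_eqVlt => /predU1P[l0|l0]; last exact: cvg_powR_gt0.
rewrite -l0 powR0//; apply/cvgrPdist_le => e e0; near=> x.
have xe : phi x <= e `^ r^-1.
  have : `|0 - phi x| <= e `^ r^-1.
    near: x; move: phil; rewrite -l0 => phil.
    by apply: cvgr_dist_le phil _ _; exact: powR_gt0.
  by rewrite sub0r normrN ger0_norm.
rewrite sub0r normrN ger0_norm ?powR_ge0//.
have -> : e = (e `^ r^-1) `^ r by rewrite -powRrM mulVf// powRr1// ltW.
by rewrite ge0_ler_powR ?nnegrE ?powR_ge0.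
Unshelve. all: by end_near. Qed.

(** At a zero of phi the power phi^r alone need not be differentiable, but psi vanishes there too:
    the difference quotient is phi^r times that of psi, and phi^r is continuous as r >= 0. The first
    term of the formula is killed by psi(w) = 0, whatever the value of the power r - 1. *)
Lemma is_derive_powR_mul (V : normedModType R) (phi psi : V -> R) w v (r d e : R) :
  0 <= r -> (forall y, 0 <= phi y) -> (phi w = 0 -> psi w = 0) ->
  is_derive w v phi d -> is_derive w v psi e ->
  is_derive w v (fun y => phi y `^ r * psi y)
    (r * phi w `^ (r - 1) * d * psi w + phi w `^ r * e).
Proof.
move=> r0 phi0 phipsi dphi dpsi.
have [p0|p0] := eqVneq (phi w) 0; last first.
  have {}p0 : 0 < phi w by rewrite lt_def p0 phi0.
  by have := is_derive_mul (is_derive_comp1 (is_derive1_powR r p0) dphi) dpsi.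
have psi0 := phipsi p0; rewrite psi0 mulr0 add0r.
have cphi : phi (h *: v + w) @[h --> (0 : R)^'] --> phi w.
  have [D _] := is_derive_line0 dphi.
  have Df : differentiable (fun s : R => phi (s *: v + w)) 0.
    exact/derivable1_diffP.
  have c : phi (s *: v + w) @[s --> (0 : R)] --> phi (0 *: v + w).
    exact: differentiable_continuous Df.
  by rewrite scale0r add0r in c; exact: cvg_within_filter c.
have qpsi : h^-1 *: (psi (h *: v + w) - psi w) @[h --> (0 : R)^'] --> e.
  by have [D <-] := dpsi; exact: D.
suff L : (fun h => h^-1 *: (phi (h *: v + w) `^ r * psi (h *: v + w)
     - phi w `^ r * psi w)) @ (0 : R)^' --> phi w `^ r * e.
  by split; [apply/cvg_ex; eexists; exact: L|apply/cvg_lim].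
have -> : (fun h => h^-1 *: (phi (h *: v + w) `^ r * psi (h *: v + w)
     - phi w `^ r * psi w)) =
   (fun h => phi (h *: v + w) `^ r * (h^-1 *: (psi (h *: v + w) - psi w))).
  by apply/funext => h; rewrite psi0 mulr0 !subr0 /GRing.scale/=; ring.
by apply: cvgM qpsi; apply: cvg_powR.
Qed.

End PowerDerivatives.

(** * Complex derivatives in real coordinates *)

Section ComplexFormulas.
Variables (R : realType) (n : nat).
Local Notation pt := 'rV[R]_(n + n).
Implicit Types (w : pt) (f : pt -> R[i]).

Local Notation lsh := (lshift n).
Local Notation rsh := (rshift n).

Lemma natrC (m : nat) : m%:R = (m%:R : R)%:C%C :> R[i].
Proof. by rewrite rmorph_nat. Qed.

Lemma div2C (a b : R) : ((a +i* b) / 2%:R = (a / 2) +i* (b / 2))%C.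
Proof.
rewrite natrC -fmorphV; apply/eqP; rewrite eq_complex/=.
by rewrite !mulr0 subr0 add0r !eqxx.
Qed.

Lemma dzE k f w : dz k f w =
  (((pdR (lsh k) (reF f) w + pdR (rsh k) (imF f) w) / 2)
   +i* ((pdR (lsh k) (imF f) w - pdR (rsh k) (reF f) w) / 2))%C.
Proof.
rewrite /dz /pdC -div2C; congr (_ / _).
by apply/eqP; rewrite eq_complex/=; apply/andP; split; apply/eqP; ring.
Qed.

Lemma dzbE k f w : dzb k f w =
  (((pdR (lsh k) (reF f) w - pdR (rsh k) (imF f) w) / 2)
   +i* ((pdR (lsh k) (imF f) w + pdR (rsh k) (reF f) w) / 2))%C.
Proof.
rewrite /dzb /pdC -div2C; congr (_ / _).
by apply/eqP; rewrite eq_complex/=; apply/andP; split; apply/eqP; ring.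
Qed.

Lemma cabs_sqr (z : R[i]) : cabs z ^+ 2 = complex.Re z ^+ 2 + complex.Im z ^+ 2.
Proof. by case: z => a b; rewrite /cabs/= sqr_sqrtr// addr_ge0 ?sqr_ge0. Qed.

Lemma cabs_ge0 (z : R[i]) : 0 <= cabs z.
Proof. by case: z => a b; rewrite /cabs/= sqrtr_ge0. Qed.

Lemma sum_ord_split (F : 'I_(n + n) -> R) :
  \sum_j F j = \sum_(k < n) (F (lsh k) + F (rsh k)).
Proof. by rewrite big_split_ord/= big_split. Qed.

Lemma normDf_ge0 f w : 0 <= normDf f w.
Proof. by rewrite /normDf sqrtr_ge0. Qed.

(** Parallelogram identity for (f_x - i f_y) / 2 and (f_x + i f_y) / 2, whence the factor 2. *)
Lemma normDf_sqr f w :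
  2 * normDf f w ^+ 2 = grad_sq (reF f) w + grad_sq (imF f) w.
Proof.
rewrite /normDf sqr_sqrtr; last first.
  by apply: sumr_ge0 => k _; rewrite addr_ge0 ?sqr_ge0.
rewrite /grad_sq !sum_ord_split -big_split mulr_sumr; apply: eq_bigr => k _.
rewrite !cabs_sqr dzE dzbE; cbn [complex.Re complex.Im].
move: (pdR _ _ _) (pdR _ _ _) (pdR _ _ _) (pdR _ _ _) => a b c d.
by rewrite /=; field.
Qed.

Lemma Re_sum (I : Type) (s : seq I) (F : I -> R[i]) :
  complex.Re (\sum_(i <- s) F i) = \sum_(i <- s) complex.Re (F i).
Proof.
elim: s => [|i s IH]; first by rewrite !big_nil.
by rewrite !big_cons -IH; case: (F i) => a b; case: (\sum_(j <- s) F j).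
Qed.

Lemma Im_sum (I : Type) (s : seq I) (F : I -> R[i]) :
  complex.Im (\sum_(i <- s) F i) = \sum_(i <- s) complex.Im (F i).
Proof.
elim: s => [|i s IH]; first by rewrite !big_nil.
by rewrite !big_cons -IH; case: (F i) => a b; case: (\sum_(j <- s) F j).
Qed.

Lemma Re_mulnC (m : nat) (z : R[i]) : complex.Re (m%:R * z) = m%:R * complex.Re z.
Proof. by rewrite natrC; case: z => a b /=; rewrite mul0r subr0. Qed.

Lemma Im_mulnC (m : nat) (z : R[i]) : complex.Im (m%:R * z) = m%:R * complex.Im z.
Proof. by rewrite natrC; case: z => a b /=; rewrite mul0r addr0. Qed.

Lemma is_derive_half w j (g1 g2 : pt -> R) (d1 d2 c : R) :
  is_derive w (delta_mx ord0 j) g1 d1 -> is_derive w (delta_mx ord0 j) g2 d2 ->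
  is_derive w (delta_mx ord0 j) (fun y => (g1 y + c * g2 y) / 2) ((d1 + c * d2) / 2).
Proof.
move=> h1 h2.
have h3 := is_derive_mul (is_derive_cst c w (delta_mx ord0 j)) h2.
have := is_derive_mul (is_derive_add h1 h3) (is_derive_cst (2^-1 : R) w (delta_mx ord0 j)).
by congr is_derive; rewrite mulr0 addr0 mul0r add0r.
Qed.

Lemma pdR_half w j (g1 g2 : pt -> R) (c : R) :
  is_derive w (delta_mx ord0 j) g1 (pdR j g1 w) ->
  is_derive w (delta_mx ord0 j) g2 (pdR j g2 w) ->
  pdR j (fun y => (g1 y + c * g2 y) / 2) w = (pdR j g1 w + c * pdR j g2 w) / 2.
Proof. by move=> h1 h2; apply: pdR_val; exact: is_derive_half. Qed.

Lemma reF_dzb k f : reF (dzb k f) =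
  fun w => (pdR (lsh k) (reF f) w + -1 * pdR (rsh k) (imF f) w) / 2.
Proof. by apply/funext => w; rewrite /reF dzbE/= mulN1r. Qed.

Lemma imF_dzb k f : imF (dzb k f) =
  fun w => (pdR (lsh k) (imF f) w + 1 * pdR (rsh k) (reF f) w) / 2.
Proof. by apply/funext => w; rewrite /imF dzbE/= mul1r. Qed.

(** For real F the mixed partials enter the imaginary part only, so pure second derivatives suffice;
    nothing has to be shown about the mixed partials of |f|^p. *)
Lemma Re_lap_real (F : pt -> R) w :
  (forall j, is_derive w (delta_mx ord0 j) (pdR j F) (pdR j (pdR j F) w)) ->
  complex.Re (lap (fun y => (F y)%:C%C) w) = laplacian F w.
Proof.
move=> dF; rewrite /lap Re_mulnC Re_sum mulr_sumr /laplacian sum_ord_split.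
apply: eq_bigr => k _; rewrite dzE/= reF_dzb imF_dzb.
have im0 j : pdR j (imF (fun y => (F y)%:C%C)) = cst 0.
  by apply/funext => y; apply: pdR_val; exact: is_derive_cst.
rewrite !im0 (_ : reF (fun y => (F y)%:C%C) = F)//.
have z j : is_derive w (delta_mx ord0 j) (cst 0 : pt -> R) (pdR j (cst 0) w).
  by rewrite (pdR_val (is_derive_cst (0 : R) w _)); exact: is_derive_cst.
rewrite (pdR_half _ (dF _) (z _)) (pdR_half _ (z _) (dF _)) !(pdR_val (is_derive_cst (0 : R) w _)).
by move: (pdR _ (pdR _ _) _) (pdR _ (pdR _ _) _) => a b; rewrite /cst; field.
Qed.

(** The mixed partials of each component of f enter the other component of the Laplacian, where they
    cancel by symmetry of second derivatives. *)
Lemma lap_C2 f w : CkC 2 f -> ball_n w ->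
  lap f w = (laplacian (reF f) w +i* laplacian (imF f) w)%C.
Proof.
move=> [u2 v2] wB; rewrite /lap.
have du i j := CkR_is_derive i (CkR_pd j u2) wB.
have dv i j := CkR_is_derive i (CkR_pd j v2) wB.
apply/eqP; rewrite eq_complex Re_mulnC Im_mulnC Re_sum Im_sum !mulr_sumr.
rewrite /laplacian !sum_ord_split; apply/andP; split; apply/eqP;
  apply: eq_bigr => k _; rewrite dzE/= reF_dzb imF_dzb.
  rewrite (pdR_half _ (du _ _) (dv _ _)) (pdR_half _ (dv _ _) (du _ _)).
  rewrite (pdRC (lsh k) (rsh k) v2 wB).
  by move: (pdR _ (pdR _ _) _) (pdR _ (pdR _ _) _) (pdR _ (pdR _ _) _) => a b c; field.
rewrite (pdR_half _ (du _ _) (dv _ _)) (pdR_half _ (dv _ _) (du _ _)).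
rewrite (pdRC (lsh k) (rsh k) u2 wB).
by move: (pdR _ (pdR _ _) _) (pdR _ (pdR _ _) _) (pdR _ (pdR _ _) _) => a b c; field.
Qed.

(** Puts the second positivity hypothesis in the real form <grad u, grad Lap u> + <grad v, grad Lap
    v> that Bochner's formula requires. *)
Lemma Re_grad_lap f w :
  complex.Re (\sum_(k < n) ((dz k f w)^* * dz k (lap f) w
     + (dzb k f w)^* * dzb k (lap f) w))%C =
  2^-1 * \sum_j (pdR j (reF f) w * pdR j (reF (lap f)) w +
                 pdR j (imF f) w * pdR j (imF (lap f)) w).
Proof.
rewrite Re_sum sum_ord_split mulr_sumr; apply: eq_bigr => k _.
rewrite !dzE !dzbE; cbn -[pdR lap].
move: (pdR (lsh k) (reF f) w) (pdR (rsh k) (reF f) w) (pdR (lsh k) (imF f) w)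
  (pdR (rsh k) (imF f) w) => a b c d.
move: (pdR (lsh k) (reF (lap f)) w) (pdR (rsh k) (reF (lap f)) w)
  (pdR (lsh k) (imF (lap f)) w) (pdR (rsh k) (imF (lap f)) w) => a' b' c' d'.
by field.
Qed.

Lemma norm_Re_mul_conj (z t : R[i]) :
  `|complex.Re z * complex.Re t + complex.Im z * complex.Im t| <= cabs z * cabs t.
Proof.
rewrite -(@ler_pXn2r _ 2) ?nnegrE ?mulr_ge0 ?cabs_ge0//.
rewrite real_normK ?num_real// exprMn !cabs_sqr -subr_ge0.
set a := complex.Re z; set b := complex.Im z; set c := complex.Re t; set d := complex.Im t.
have -> : (a ^+ 2 + b ^+ 2) * (c ^+ 2 + d ^+ 2) - (a * c + b * d) ^+ 2 =
  (a * d - b * c) ^+ 2 by ring.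
exact: sqr_ge0.
Qed.

End ComplexFormulas.

(** * Integrals over the whole ball *)

Section Cutoff.
Variables (R : realType) (n : nat).
Local Notation pt := 'rV[R]_(n + n).
Implicit Types (w z : pt) (F : pt -> R).

Lemma dist_bd_gt0 w : ball_n w -> 0 < dist_bd w.
Proof. by rewrite /ball_n/= /dist_bd subr_gt0. Qed.

Lemma dist_bd_le1 w : dist_bd w <= 1.
Proof. by rewrite /dist_bd lerBlDr lerDl enorm_ge0. Qed.

Lemma continuous_dist_bd : continuous (@dist_bd R n).
Proof.
by move=> w; apply: continuousB; [exact: cst_continuous|exact: continuous_enorm].
Qed.

(** For j > 0 this is 0 where the distance is at most 1/j and 1 where it is at least 2/j. The shift
    by -1 makes it vanish near the sphere, so its product with a function continuous only inside the
    ball is continuous everywhere. *)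
Definition cutoff (j : nat) w := Num.min 1 (Num.max 0 (j%:R * dist_bd w - 1)).

Lemma cutoff_ge0 j w : 0 <= cutoff j w.
Proof. by rewrite /cutoff le_min ler01 le_max lexx. Qed.

Lemma cutoff_le1 j w : cutoff j w <= 1.
Proof. by rewrite /cutoff ge_min lexx. Qed.

Lemma cutoff_eq0 j w : j%:R * dist_bd w <= 1 -> cutoff j w = 0.
Proof. by move=> h; rewrite /cutoff (max_l (_ : _ <= _)) ?subr_le0// min_r. Qed.

Lemma cutoff_out j w : ~ ball_n w -> cutoff j w = 0.
Proof.
move=> wB; apply: cutoff_eq0; rewrite (le_trans _ ler01)//.
rewrite mulr_ge0_le0 ?ler0n// /dist_bd subr_le0 leNgt; exact/negP.
Qed.

Lemma cutoff_nd w : nondecreasing_seq (fun j => cutoff j w).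
Proof.
move=> i j ij; have [wB|wB] := pselect (ball_n w); last by rewrite !cutoff_out.
rewrite /cutoff le_min !ge_min lexx/=; apply/orP; right.
rewrite ge_max !le_max lexx/= lerD2r ler_wpM2r ?ler_nat ?orbT//.
by rewrite ltW// dist_bd_gt0.
Qed.

Lemma cutoff_cvg w : ball_n w -> cutoff j w @[j --> \oo] --> (1 : R).
Proof.
move=> /dist_bd_gt0 d0; apply: cvg_near_cst.
near=> j; have h : 2 / dist_bd w <= j%:R by near: j; exact: nbhs_infty_ger.
move: h; rewrite ler_pdivrMr// => h.
by rewrite /cutoff min_l// le_max; apply/orP; right; lra.
Unshelve. all: by end_near. Qed.

Lemma continuous_cutoff_mul F j : cont_ball F ->
  continuous (fun w => cutoff j w * F w).
Proof.
move=> cF w.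
have cd : {for w, continuous (fun w => j%:R * dist_bd w - 1)}.
  apply: continuousB; last exact: cst_continuous.
  by apply: continuousM; [exact: cst_continuous|exact: continuous_dist_bd].
have [wB|wB] := pselect (ball_n w).
  apply: continuousM; last exact: cF.
  have c0 : {for w, continuous (fun _ : pt => 0 : R)} by exact: cst_continuous.
  have c1 : {for w, continuous (fun _ : pt => 1 : R)} by exact: cst_continuous.
  exact: (continuous_min c1 (continuous_max c0 cd)).
have lt0 : j%:R * dist_bd w - 1 < 0.
  have : j%:R * dist_bd w <= 0; last by lra.
  rewrite mulr_ge0_le0 ?ler0n// /dist_bd subr_le0 leNgt; exact/negP.
apply: (@near_cst_continuous _ _ 0); near=> y.
rewrite cutoff_eq0 ?mul0r// -subr_le0 ltW//.
near: y; have c : (j%:R * dist_bd y - 1) @[y --> w] --> (j%:R * dist_bd w - 1) by exact: cd.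
exact: (cvgr_lt _ c _ lt0).
Unshelve. all: by end_near. Qed.

Lemma ucc_cutoff_mul F j : cont_ball F ->
  ucc (fun x => (fun w => cutoff j w * F w) (\row_j x j)).
Proof.
move=> cF; apply: ucc_continuous; first exact: continuous_cutoff_mul.
by move=> w /ball_out wB; rewrite cutoff_out// mul0r.
Qed.

Definition on_ball F w : \bar R := if (enorm w < 1)%R then (F w)%:E else 0%E.

Lemma on_ballT F w : ball_n w -> on_ball F w = (F w)%:E.
Proof. by rewrite /on_ball /ball_n/= => ->. Qed.

Lemma on_ballN F w : ~ ball_n w -> on_ball F w = 0%E.
Proof. by rewrite /on_ball /ball_n/= => /negP/negbTE ->. Qed.

Lemma on_ball_ge0 F w : (forall y, ball_n y -> 0 <= F y) -> (0 <= on_ball F w)%E.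
Proof. by move=> F0; rewrite /on_ball; case: ifPn => // /F0; rewrite lee_fin. Qed.

Lemma rowint_le_vint (F H : pt -> R) : ucc (fun x => F (\row_j x j)) ->
  (forall w, 0 <= F w) -> (forall w, ball_n w -> F w <= H w) ->
  (forall w, ~ ball_n w -> F w = 0) -> ((rowint F)%:E <= vint (on_ball H))%E.
Proof.
move=> uF F0 FH FN; rewrite /rowint -iint_ucc//.
apply: (le_iint (F := EFin \o (fun x => F (\row_j x j))) _ _).2 => x /=.
  by rewrite lee_fin.
have [xB|xB] := pselect (ball_n (\row_j x j)).
  by rewrite on_ballT// lee_fin; exact: FH.
by rewrite on_ballN// FN.
Qed.

Lemma vint_on_ball_le F (C : R) : cont_ball F -> (forall w, ball_n w -> 0 <= F w) ->
  (forall j, rowint (fun w => cutoff j w * F w) <= C) ->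
  (vint (on_ball F) <= C%:E)%E.
Proof.
move=> cF F0 FC.
have FF0 w j : 0 <= cutoff j w * F w.
  have [wB|wB] := pselect (ball_n w); last by rewrite cutoff_out// mul0r.
  by rewrite mulr_ge0 ?cutoff_ge0 ?F0.
have H : (rowint (fun w => cutoff j w * F w))%:E @[j --> \oo] --> vint (on_ball F).
  apply: (@iint_monotone_cvg _ _ (fun j x => cutoff j (\row_j x j) * F (\row_j x j))).
  - by move=> j; exact: ucc_cutoff_mul.
  - by move=> j x; exact: FF0.
  - move=> x i j ij; have [wB|wB] := pselect (ball_n (\row_j x j)).
      by rewrite ler_wpM2r ?F0//; exact: cutoff_nd.
    by rewrite !cutoff_out.
  - move=> x; have [wB|wB] := pselect (ball_n (\row_j x j)).
      rewrite on_ballT//; apply: cvg_EFin; first exact: nearW.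
      rewrite -[X in _ --> X]mul1r; apply: cvgM; last exact: cvg_cst.
      exact: cutoff_cvg.
    rewrite on_ballN//; under eq_fun do rewrite cutoff_out// mul0r.
    exact: cvg_cst.
by apply: (cvge_to_le H); apply: nearW => j; rewrite lee_fin.
Qed.

Lemma rowint_cutoff_le j : rowint (fun w => cutoff j w * 1) <= 2 ^+ (n + n).
Proof.
apply: le_trans (ler_norm _) _; rewrite -[leRHS]mulr1.
apply: (@iintR_norm_le _ _ (fun x => cutoff j (\row_j x j) * 1)).
  by apply: (@ucc_cutoff_mul (fun=> 1)) => w _; exact: cst_continuous.
by move=> x; rewrite mulr1 ger0_norm ?cutoff_ge0 ?cutoff_le1.
Qed.

Lemma cube_sqn_le z (eta : R) w : 0 <= eta ->
  (forall i, `|w ord0 i - z ord0 i| <= eta) ->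
  sqn (w - z) <= (n + n)%:R * eta ^+ 2.
Proof.
move=> eta0 h; rewrite /sqn mulr_natl -[X in _ *+ X]card_ord -sumr_const.
apply: ler_sum => i _; rewrite !mxE -[leLHS]real_normK ?num_real//.
by rewrite ler_pXn2r ?nnegrE.
Qed.

(** [fine] sends infinity to 0, so the normalising factor is a positive real only if the volume is
    both finite and positive: it lies between the volume of a small inner cube and that of
    [-1, 1]^(2n). *)
Lemma vol_ball_gt0 : (1 <= n)%N -> 0 < fine (vol_ball R n).
Proof.
move=> n1.
have N0 : 0 < (n + n)%:R :> R by rewrite ltr0n addn_gt0 n1.
have E : vol_ball R n = vint (on_ball (fun=> 1)) by [].
have c1 : cont_ball (fun _ : pt => 1 : R) by move=> w _; exact: cst_continuous.
have ub : (vol_ball R n <= (2 ^+ (n + n))%:E)%E.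
  by rewrite E; apply: vint_on_ball_le => //; exact: rowint_cutoff_le.
(* On the cube of half-side eta, |w|^2 <= 2n eta^2 = eta / 2 < 1. *)
pose eta : R := (2 * (n + n)%:R)^-1.
have eta0 : 0 < eta by rewrite invr_gt0 mulr_gt0.
have lb : ((1 * (2 * eta) ^+ (n + n))%:E <= vol_ball R n)%E.
  rewrite E /vint.
  apply: (@iint_cube_ge _ _ (fun x => on_ball (fun=> 1) (\row_j x j)) (fun=> 0)) => //.
    by move=> x; apply: on_ball_ge0.
  move=> x hx; rewrite on_ballT// /ball_n/= enormE -sqrtr1 ltr_sqrt//.
  have sq : sqn (\row_j x j - 0 : pt) <= (n + n)%:R * eta ^+ 2.
    by apply: cube_sqn_le; [exact: ltW|move=> i; have := hx i; rewrite !mxE].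
  rewrite subr0 in sq; apply: le_lt_trans sq _.
  have -> : (n + n)%:R * eta ^+ 2 = eta / 2.
    by rewrite /eta; move: (_%:R) N0 => N /lt0r_neq0 N0; field.
  have : eta <= 1; last by lra.
  rewrite /eta invf_le1; last by rewrite mulr_gt0.
  have : 1 <= (n + n)%:R :> R by rewrite ler1n addn_gt0 n1.
  by lra.
have p0 : 0 < (2 * eta) ^+ (n + n) by rewrite exprn_gt0// mulr_gt0.
rewrite -lte_fin fineK; last first.
  rewrite ge0_fin_numE; first exact: le_lt_trans ub (ltry _).
  by apply: le_trans lb; rewrite lee_fin mul1r ltW.
by apply: lt_le_trans lb; rewrite mul1r lte_fin.
Qed.

Lemma intVN_lty (h : pt -> R) : (1 <= n)%N ->
  (intVN h < +oo)%E <-> (vint (on_ball h) < +oo)%E.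
Proof.
move=> /vol_ball_gt0 v0; rewrite /intVN -/(on_ball h).
have c0 : 0 < (fine (vol_ball R n))^-1 by rewrite invr_gt0.
case: (vint (on_ball h)) => [r| |].
- by rewrite -EFinM !ltry.
- by rewrite gt0_muley// lte_fin.
- by rewrite gt0_muleNy ?lte_fin.
Qed.

End Cutoff.

(** * Growth estimates *)

Section GradientBound.
Variables (R : realType) (n : nat).
Local Notation pt := 'rV[R]_(n + n).
Implicit Types (w z : pt) (g u v : pt -> R).

(** The graph of x^s lies above its tangent at b, read off Young's inequality with exponents s and s
    / (s - 1); for s = 1 there is no finite conjugate exponent. *)
Lemma powR_tangent (s a b : R) : 1 <= s -> 0 <= a -> 0 <= b ->
  s * b `^ (s - 1) * a <= 1 * a `^ s + (s - 1) * b `^ s.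
Proof.
rewrite le_eqVlt => /predU1P[<-|s1] a0 b0.
  by rewrite subrr powRr0 mul0r addr0 !mul1r powRr1.
have s0 : 0 < s by exact: lt_trans s1.
have s10 : 0 < s - 1 by rewrite subr_gt0.
have := @conjugate_powR R a (b `^ (s - 1)) s (s / (s - 1)) a0 (powR_ge0 _ _) s0
  (divr_gt0 s0 s10).
have -> : s^-1 + (s / (s - 1))^-1 = 1 by field; rewrite !gt_eqF.
rewrite -powRrM (_ : (s - 1) * (s / (s - 1)) = s); last by field; rewrite gt_eqF.
move=> /(_ erefl); move: (a `^ s) (b `^ s) (b `^ (s - 1)) => x y t h.
have {h} := ler_wpM2l (ltW s0) h.
have -> : s * (x / s + y / (s / (s - 1))) = 1 * x + (s - 1) * y.
  by field; rewrite !gt_eqF.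
by rewrite mulrA mulrAC.
Qed.

Lemma sub_ball_sqr z (r : R) : ball_n z -> 0 <= r -> r < dist_bd z ->
  sub_ball z (r ^+ 2) /\ forall w, sqn (w - z) <= r ^+ 2 -> dist_bd z - r <= dist_bd w.
Proof.
move=> zB r0 rd.
have H w : sqn (w - z) <= r ^+ 2 -> enorm w <= enorm z + r.
  rewrite -enorm_sqr ler_pXn2r ?nnegrE ?enorm_ge0// => wr.
  by rewrite -{1}(subrK z w) addrC (le_trans (enormD _ _))// lerD2l.
split=> w /H wr; last by rewrite /dist_bd; lra.
by move: rd; rewrite /ball_n/= /dist_bd; lra.
Qed.

Section Subharmonic.
Variables (g : pt -> R) (gk gkk : 'I_(n + n) -> pt -> R).
Hypotheses (g_ge0 : forall w, 0 <= g w) (cg : cont_ball g)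
  (cgk : forall k, cont_ball (gk k)) (cgkk : forall k, cont_ball (gkk k)).
Hypothesis dg : forall k w, ball_n w -> is_derive w (delta_mx ord0 k) g (gk k w).
Hypothesis dgk : forall k w, ball_n w ->
  is_derive w (delta_mx ord0 k) (gk k) (gkk k w).
Hypothesis subh : forall w, ball_n w -> 0 <= \sum_k gkk k w.

Lemma cont_ball_powR (s : R) : 0 <= s -> cont_ball (fun w => g w `^ s).
Proof.
move=> s0 w wB; have c : g y @[y --> w] --> g w by exact: cg.
exact: (cvg_powR _ g_ge0 (g_ge0 w) s0 c).
Qed.

(** Showing g^s subharmonic would require differentiating it at zeros of g. Instead the tangent
    inequality at b = g(z) is integrated against the weight, its linear term being controlled by the
    mean value inequality for g. *)
Lemma powR_mean z (s t t' : R) : 1 <= s -> sub_ball z t' -> 0 < t < t' ->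
  g z `^ s * rowint (pbump z t 2) <= rowint (fun w => g w `^ s * pbump z t 2 w).
Proof.
move=> s1 sb tt'; have /andP[t0 /ltW tt] := tt'.
have sbt := sub_ball_le tt sb.
have s0 : 0 < s by exact: lt_le_trans s1.
have H := subharmonic_mean cg cgk cgkk dg dgk subh sb tt'.
have cs := cont_ball_powR (ltW s0).
have c1 : cont_ball (fun _ : pt => 1 : R) by move=> w _; exact: cst_continuous.
have u1 : ucc (fun x => pbump z t 2 (\row_j x j)).
  have := ucc_mul_bump 1 sbt c1.
  by congr ucc; apply/funext => x; rewrite mul1r.
have ug := ucc_mul_bump 1 sbt cg; have us := ucc_mul_bump 1 sbt cs.
have A0 : 0 <= s * g z `^ (s - 1) by rewrite mulr_ge0 ?powR_ge0// ltW.
have := ler_wpM2l A0 H.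
have -> : s * g z `^ (s - 1) * (g z * rowint (pbump z t 2)) =
    s * (g z * g z `^ (s - 1)) * rowint (pbump z t 2) by ring.
rewrite mulr_powRB1// /rowint.
have L : iintR (fun x => s * g z `^ (s - 1) *
      (g (\row_j x j) * pbump z t 2 (\row_j x j))) <=
    iintR (fun x => (s - 1) * g z `^ s * pbump z t 2 (\row_j x j) +
       g (\row_j x j) `^ s * pbump z t 2 (\row_j x j)).
  apply: le_iintR; [exact: ucc_scale|exact: ucc_lin|move=> x].
  rewrite mulrA -mulrDl ler_wpM2r ?bump_ge0//.
  by rewrite [leRHS]addrC -[X in _ <= X + _]mul1r; exact: powR_tangent.
rewrite iintR_scale// iintR_lin// in L; move=> /le_trans/(_ L).
by move: (g z `^ s) (iintR _) (iintR _) => *; lra.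
Qed.

(** On |w - z| <= d(z) / 2 one has d(w)^gamma >= (d(z) / 2)^gamma, so the total integral controls
    the local one; after normalisation the weight has mass of order d(z)^(2n). *)
Lemma subharmonic_growth (s gamma : R) (h : pt -> R) (V : R) :
  (1 <= n)%N -> 1 <= s -> 0 < gamma -> (vint (on_ball h) <= V%:E)%E ->
  (forall w, ball_n w -> dist_bd w `^ gamma * g w `^ s <= h w) ->
  exists2 C, 0 <= C & forall z, ball_n z ->
    g z `^ s <= C * dist_bd z `^ (- ((2 * n)%:R + gamma)).
Proof.
move=> n1 s1 gam0 hV gh; pose N := (n + n)%N.
have N0 : 0 < N%:R :> R by rewrite ltr0n addn_gt0 n1.
have s0 : 0 < s by exact: lt_le_trans s1.
exists (4 * `|V| * (2 * N%:R) ^+ N * 2 `^ gamma).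
  have pN : 0 <= (2 * N%:R) ^+ N :> R by rewrite exprn_ge0// mulr_ge0// ltW.
  by rewrite !mulr_ge0// powR_ge0.
move=> z zB; set D := dist_bd z.
have D0 : 0 < D by exact: dist_bd_gt0.
pose t := (D / 2) ^+ 2.
have D2 : 0 < D / 2 by rewrite divr_gt0.
have t0 : 0 < t by rewrite exprn_gt0.
(* The radius 3 D / 4 leaves room beyond D / 2 for differentiating in the radius. *)
have [sb' _] : sub_ball z ((D * (3 / 4)) ^+ 2) /\ forall w,
    sqn (w - z) <= (D * (3 / 4)) ^+ 2 -> D - D * (3 / 4) <= dist_bd w.
  by apply: sub_ball_sqr => //; rewrite -/D; lra.
have [sb dw] : sub_ball z t /\ forall w, sqn (w - z) <= t -> D - D / 2 <= dist_bd w.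
  by apply: sub_ball_sqr => //; rewrite -/D; lra.
have tt' : 0 < t < (D * (3 / 4)) ^+ 2 by rewrite t0/= /t ltr_pXn2r ?nnegrE//; lra.
have H := powR_mean s1 sb' tt'.
have us := ucc_mul_bump 1 sb (cont_ball_powR (ltW s0)).
(* As b^2 <= t^2, the weight kappa b^2 is at most (D / 2)^gamma, hence at most d(w)^gamma. *)
pose kappa := (D / 2) `^ gamma / t ^+ 2.
have kappa0 : 0 < kappa by rewrite divr_gt0 ?powR_gt0 ?exprn_gt0.
have up : kappa * rowint (fun w => g w `^ s * pbump z t 2 w) <= `|V|.
  apply: le_trans (ler_norm V); rewrite -lee_fin; apply: le_trans hV.
  rewrite /rowint -iintR_scale//.
  apply: (@rowint_le_vint _ _ (fun w => kappa * (g w `^ s * pbump z t 2 w))).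
  - exact: ucc_scale.
  - by move=> w; rewrite mulr_ge0 ?(ltW kappa0)// mulr_ge0 ?powR_ge0 ?bump_ge0.
  - move=> w wB; apply: le_trans (gh w wB).
    have [wt|wt] := leP t (sqn (w - z)).
      by rewrite bump_eq0// !mulr0 mulr_ge0 ?powR_ge0.
    have b1 : pbump z t 2 w <= t ^+ 2.
      rewrite /pbump ler_pXn2r ?nnegrE ?le_max ?lexx ?(ltW t0)//.
      by rewrite ge_max (ltW t0)/= gerBl sqn_ge0.
    have d1 : (D / 2) `^ gamma <= dist_bd w `^ gamma.
      have h1 := dw w (ltW wt).
      rewrite ge0_ler_powR ?nnegrE ?(ltW gam0) ?(ltW D2)//; last by lra.
      by rewrite ltW// dist_bd_gt0.
    have t20 : 0 < t ^+ 2 by rewrite exprn_gt0.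
    have -> : kappa * (g w `^ s * pbump z t 2 w) =
        (D / 2) `^ gamma * g w `^ s * (pbump z t 2 w / t ^+ 2) by rewrite /kappa; ring.
    apply: le_trans (_ : (D / 2) `^ gamma * g w `^ s <= _).
      by rewrite ler_piMr ?mulr_ge0 ?powR_ge0// ler_pdivrMr// mul1r.
    by rewrite ler_wpM2r ?powR_ge0.
  - move=> w wB; rewrite bump_eq0 ?mulr0//.
    by rewrite leNgt; apply/negP => /ltW /sb.
(* On the cube of half-side eta around z, |w - z|^2 <= D^2 / (16 N) <= t / 2, so b^2 >= (t /
   2)^2. *)
pose eta := D / (4 * N%:R).
have eta0 : 0 < eta by rewrite divr_gt0// mulr_gt0.
have low : (t / 2) ^+ 2 * (2 * eta) ^+ N <= rowint (pbump z t 2).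
  have u1 : ucc (fun x => pbump z t 2 (\row_j x j)).
    have c1 : cont_ball (fun _ : pt => 1 : R) by move=> w _; exact: cst_continuous.
    have := ucc_mul_bump 1 sb c1.
    by congr ucc; apply/funext => x; rewrite mul1r.
  rewrite -lee_fin /rowint -iint_ucc//.
  apply: (@iint_cube_ge _ _ _ (fun i => z ord0 i)) => //.
  - exact: sqr_ge0.
  - by move=> x; rewrite lee_fin bump_ge0.
  - move=> x hx; rewrite lee_fin /pbump ler_pXn2r ?nnegrE ?le_max ?lexx//; last first.
      by rewrite divr_ge0// ltW.
    apply/orP; right.
    have : sqn (\row_j x j - z) <= (n + n)%:R * eta ^+ 2.
      by apply: cube_sqn_le; [exact: ltW|move=> i; have := hx i; rewrite !mxE].
    suff : (n + n)%:R * eta ^+ 2 <= t / 2 by lra.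
    have N1 : 1 <= N%:R :> R by rewrite ler1n addn_gt0 n1.
    have -> : (n + n)%:R * eta ^+ 2 = (t / 2) * (2 * N%:R)^-1.
      by rewrite /eta /t -/N; move: (N%:R) N0 => N' /lt0r_neq0 N0'; field.
    rewrite ler_piMr ?divr_ge0 ?(ltW t0)// invf_le1 ?mulr_gt0//.
    by lra.
set Y := g z `^ s.
have Y0 : 0 <= Y by exact: powR_ge0.
have : kappa * (Y * ((t / 2) ^+ 2 * (2 * eta) ^+ N)) <= `|V|.
  apply: le_trans up; rewrite ler_wpM2l ?(ltW kappa0)//.
  by apply: le_trans H; rewrite ler_wpM2l.
have -> : 2 * eta = D / (2 * N%:R).
  by rewrite /eta; move: (N%:R) N0 => N' /lt0r_neq0 N0'; field.
have -> : kappa * (Y * ((t / 2) ^+ 2 * (D / (2 * N%:R)) ^+ N)) =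
    Y * ((D / 2) `^ gamma / 4 * (D / (2 * N%:R)) ^+ N).
  rewrite /kappa; move: (_ ^+ N) => x; move: (_ `^ _) => y.
  by field; rewrite gt_eqF.
rewrite powRM ?(ltW D0)// expr_div_n.
have -> : 2^-1 `^ gamma = (2 `^ gamma)^-1 :> R.
  by rewrite -powR_inv1// -powRrM mulN1r powRN.
have -> : (2 * n)%N = N by rewrite /N mul2n addnn.
have -> : D `^ (- (N%:R + gamma)) = (D ^+ N)^-1 * (D `^ gamma)^-1.
  by rewrite powRN powRD ?(gt_eqF D0) ?implybT// invfM powR_mulrn// ltW.
have g2 : 0 < 2 `^ gamma :> R by rewrite powR_gt0.
have Dg : 0 < D `^ gamma by rewrite powR_gt0.
have DN : 0 < D ^+ N by rewrite exprn_gt0.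
have NN : 0 < (2 * N%:R) ^+ N :> R by rewrite exprn_gt0// mulr_gt0.
move: (D `^ gamma) (D ^+ N) (2 `^ gamma) ((2 * N%:R) ^+ N) Dg DN g2 NN
  => a b c d a0 b0 c0 d0.
have -> : Y * (a * c^-1 / 4 * (b / d)) = Y * (a * b) / (4 * c * d).
  by field; rewrite !gt_eqF.
rewrite ler_pdivrMr ?mulr_gt0// => K.
have -> : 4 * `|V| * d * c * (b^-1 * a^-1) = `|V| * (4 * c * d) / (a * b).
  by field; rewrite !gt_eqF.
by rewrite ler_pdivlMr// mulr_gt0.
Qed.

End Subharmonic.

(** Along the ray to w, the derivative of sg g is at most rho C (1 - t rho)^(-q-1), the derivative
    of C / q times (1 - t rho)^(-q). The sign [sg] treats g and -g at once. *)
Lemma radial_bound g (sg C q : R) : sg ^+ 2 = 1 -> CkR 1 g -> 0 <= C -> 0 < q ->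
  (forall w, ball_n w -> grad_sq g w <= (C * dist_bd w `^ (- (q + 1))) ^+ 2) ->
  forall w, ball_n w -> sg * g w <= sg * g 0 + C / q * dist_bd w `^ (- q).
Proof.
move=> sg1 g1 C0 q0 gC w wB; set rho := enorm w.
have rho0 : 0 <= rho by exact: enorm_ge0.
have rho1 : rho < 1 by exact: wB.
have dt (t : R) : 0 <= t -> dist_bd (t *: w + 0) = 1 - t * rho.
  move=> t0; rewrite /dist_bd addr0 /rho !enormE; congr (1 - _).
  have -> : sqn (t *: w) = t ^+ 2 * sqn w.
    by rewrite /sqn mulr_sumr; apply: eq_bigr => i _; rewrite mxE exprMn.
  by rewrite sqrtrM ?sqr_ge0// sqrtr_sqr ger0_norm.
have pos (t : R) : 0 <= t -> t <= 1 -> 0 < 1 - t * rho.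
  by move=> t0 t1; rewrite subr_gt0; nra.
have inB (t : R) : 0 <= t -> t <= 1 -> ball_n (t *: w + 0).
  by move=> t0 t1; have := pos t t0 t1; rewrite -dt// /dist_bd subr_gt0.
pose S (t : R) := sg * \sum_k w ord0 k * pdR k g (t *: w + 0).
pose P (t : R) := (1 - t * rho) `^ (- q).
pose P' (t : R) := - q * (1 - t * rho) `^ (- q - 1) * (- rho).
have dF (t : R) : 0 <= t -> t <= 1 ->
    is_derive t 1 (fun t => sg * g (t *: w + 0) + - (C / q) * P t)
      (S t + - (C / q) * P' t).
  move=> t0 t1; apply: is_derive_add.
    have h0 : is_derive t 1 (fun t => g (t *: w + 0))
        (\sum_k w ord0 k * pdR k g (t *: w + 0)).
      by apply/is_derive_lineP; apply: C1_is_derive g1 _; exact: inB.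
    by have := is_derive_mul (is_derive_cst sg t (1 : R)) h0; rewrite mul0r add0r.
  have h1 : is_derive t 1 (fun t : R => 1 - t * rho) (- rho).
    have := is_deriveB (is_derive_cst (1 : R) t 1)
      (is_derive_mul (is_derive_id t (1 : R)) (is_derive_cst rho t (1 : R))).
    by rewrite mulr0 addr0 mul1r sub0r.
  have h2 := @is_derive_comp1 _ _ (fun x => x `^ (- q)) (fun t : R => 1 - t * rho) t 1
    _ _ (is_derive1_powR (- q) (pos t t0 t1)) h1.
  by have := is_derive_mul (is_derive_cst (- (C / q)) t (1 : R)) h2; rewrite mul0r add0r.
pose Q (t : R) := sg * g (t *: w + 0) + - (C / q) * P t.
pose Q' (t : R) := S t + - (C / q) * P' t.
have D01 (t : R) : t \in `[0, 1]%R -> is_derive t 1 Q (Q' t).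
  by rewrite in_itv/= => /andP[]; exact: dF.
have cQ : {within `[0, 1], continuous Q}.
  by apply: derivable_within_continuous => t /D01[].
have [t tI] := MVT_segment ler01 (fun t tI => D01 t (subset_itv_oo_cc tI)) cQ.
rewrite /Q /Q'.
have /andP[t0 t1] : 0 <= t <= 1 by move: tI; rewrite in_itv.
rewrite scale1r scale0r !addr0 subr0 mulr1 => E.
have P1 : P 1 = dist_bd w `^ (- q) by rewrite /P mul1r.
have P0 : 0 <= C / q * P 0 by rewrite mulr_ge0 ?powR_ge0// divr_ge0// ltW.
have S0 : S t + - (C / q) * P' t <= 0.
  have -> : - (C / q) * P' t = - (rho * (C * (1 - t * rho) `^ (- q - 1))).
    by rewrite /P'; move: (_ `^ _) => x; field; rewrite gt_eqF.
  rewrite subr_le0.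
  pose G : pt := \row_k (sg * pdR k g (t *: w + 0)).
  have -> : S t = \sum_k w ord0 k * G ord0 k.
    by rewrite /S mulr_sumr; apply: eq_bigr => k _; rewrite mxE mulrCA.
  apply: le_trans (sum_mul_le_enorm _ _) _; rewrite ler_wpM2l//.
  have gt := gC _ (inB t t0 t1).
  rewrite -(@ler_pXn2r _ 2) ?nnegrE ?enorm_ge0 ?mulr_ge0 ?powR_ge0//.
  rewrite enorm_sqr; move: gt; rewrite dt// opprD; apply: le_trans.
  by rewrite /sqn /grad_sq; apply: ler_sum => k _; rewrite mxE exprMn sg1 mul1r.
by rewrite -P1; lra.
Qed.

Lemma radial_norm_bound g (C q : R) : CkR 1 g -> 0 <= C -> 0 < q ->
  (forall w, ball_n w -> grad_sq g w <= (C * dist_bd w `^ (- (q + 1))) ^+ 2) ->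
  forall w, ball_n w -> `|g w| <= `|g 0| + C / q * dist_bd w `^ (- q).
Proof.
move=> g1 C0 q0 gC w wB; rewrite ler_norml; apply/andP; split.
  have := radial_bound (sg := -1) _ g1 C0 q0 gC wB; rewrite sqrrN expr1n => /(_ erefl).
  by have := ler_norm (- g 0); rewrite normrN !mulN1r; lra.
have := radial_bound (sg := 1) _ g1 C0 q0 gC wB; rewrite expr1n => /(_ erefl).
by have := ler_norm (g 0); rewrite !mul1r; lra.
Qed.

End GradientBound.

(** * The Laplacian of |f|^p *)

Section PowerLaplacian.
Variables (R : realType) (n : nat).
Local Notation pt := 'rV[R]_(n + n).
Implicit Types (w z : pt).

Variables (f : pt -> R[i]) (p : R).
Hypotheses (f2 : CkC 2 f) (p2 : 2 <= p).

(** With phi = |f|^2 one has |f|^p = phi^s; [psi j] and [e j] are the first and second partials of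
    phi. *)
Let s := p / 2.
Let u := reF f.
Let v := imF f.
Let phi w := u w ^+ 2 + v w ^+ 2.
Let psi j w := 2 * (u w * pdR j u w + v w * pdR j v w).
Let e j w := 2 * (pdR j u w ^+ 2 + u w * pdR j (pdR j u) w +
                  (pdR j v w ^+ 2 + v w * pdR j (pdR j v) w)).

Let s1 : 1 <= s. Proof. by rewrite /s ler_pdivlMr// mul1r. Qed.

Let s0 : 0 < s. Proof. exact: lt_le_trans s1. Qed.

Let sB0 : 0 <= s - 1. Proof. by rewrite subr_ge0. Qed.

Let phi_ge0 w : 0 <= phi w. Proof. by rewrite addr_ge0 ?sqr_ge0. Qed.

Let phi_eq0 w : phi w = 0 -> u w = 0 /\ v w = 0.
Proof.
move=> /eqP; rewrite /phi paddr_eq0 ?sqr_ge0// !sqrf_eq0.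
by move=> /andP[/eqP -> /eqP ->].
Qed.

Let psi_eq0 j w : phi w = 0 -> psi j w = 0.
Proof. by move=> /phi_eq0[uw vw]; rewrite /psi uw vw !mul0r addr0 mulr0. Qed.

Lemma cabs_sqrt w : cabs (f w) = Num.sqrt (phi w).
Proof. by rewrite /phi -cabs_sqr sqrtr_sqr ger0_norm// cabs_ge0. Qed.

Let cabs_powR w r : cabs (f w) `^ r = phi w `^ (r / 2).
Proof. by rewrite cabs_sqrt -powR12_sqrt// -powRrM mulrC. Qed.

Let is_derive_phi j w : ball_n w -> is_derive w (delta_mx ord0 j) phi (psi j w).
Proof.
move=> wB; have du := is_derive_sqr (CkR_is_derive j f2.1 wB).
have dv := is_derive_sqr (CkR_is_derive j f2.2 wB).
by apply: (is_derive_eq (is_derive_add du dv)); rewrite -mulrDr.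
Qed.

Let is_derive_psi j w : ball_n w -> is_derive w (delta_mx ord0 j) (psi j) (e j w).
Proof.
move=> wB; have du := CkR_is_derive j f2.1 wB; have dv := CkR_is_derive j f2.2 wB.
have duu := CkR_is_derive j (CkR_pd j f2.1) wB.
have dvv := CkR_is_derive j (CkR_pd j f2.2) wB.
apply: (is_derive_eq (is_derive_mul (is_derive_cst (2 : R) w _)
  (is_derive_add (is_derive_mul du duu) (is_derive_mul dv dvv)))).
by rewrite mul0r add0r.
Qed.

Let is_derive_pow j w : ball_n w ->
  is_derive w (delta_mx ord0 j) (fun y => cabs (f y) `^ p)
    (s * (phi w `^ (s - 1) * psi j w)).
Proof.
move=> wB.
(* Splitting off one factor phi leaves the exponent s - 1 >= 0 and a cofactor that vanishes at the
   zeros of f. *)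
have -> : (fun y => cabs (f y) `^ p) = fun y => phi y `^ (s - 1) * phi y.
  by apply/funext => y; rewrite cabs_powR [RHS]mulrC mulr_powRB1.
apply: (is_derive_eq (is_derive_powR_mul sB0 phi_ge0 id (is_derive_phi j wB)
  (is_derive_phi j wB))).
have [p0|p0] := eqVneq (phi w) 0; first by rewrite psi_eq0// !(mulr0, mul0r) addr0.
have E : phi w `^ (s - 1) = phi w `^ (s - 1 - 1) * phi w.
  have pw : 0 < phi w by rewrite lt_def p0 phi_ge0.
  rewrite -{3}(powRr1 (ltW pw)) -powRD ?(negbTE p0) ?implybT//.
  by congr powR; ring.
rewrite E; move: (phi w `^ (s - 1 - 1)) (phi w) (psi j w) => a b c.
by ring.
Qed.

Let pdR_pow j w : ball_n w -> pdR j (fun y => cabs (f y) `^ p) w =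
  s * (phi w `^ (s - 1) * psi j w).
Proof. by move=> wB; apply: pdR_val; exact: is_derive_pow. Qed.

Let is_derive_pow2 j w : ball_n w ->
  is_derive w (delta_mx ord0 j) (pdR j (fun y => cabs (f y) `^ p))
    (s * ((s - 1) * phi w `^ (s - 1 - 1) * psi j w * psi j w
       + phi w `^ (s - 1) * e j w)).
Proof.
move=> wB.
have D := is_derive_powR_mul sB0 phi_ge0 (@psi_eq0 j w) (is_derive_phi j wB)
  (is_derive_psi j wB).
have {}D := is_derive_mul (is_derive_cst s w (delta_mx ord0 j)) D.
rewrite mul0r add0r in D.
apply: near_eq_is_derive D; near=> y; rewrite pdR_pow//.
by near: y; exact: near_ball_n.
Unshelve. all: by end_near. Qed.

(** The dangerous term phi^(s-2) psi_j^2 is tamed by Cauchy-Schwarz, psi_j^2 <= 4 phi (u_j^2 +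
    v_j^2), which restores the exponent s - 1; at zeros of f it vanishes with psi_j. *)
Lemma norm_lap_powR_le w : ball_n w ->
  `|complex.Re (lap (fun y => (cabs (f y) `^ p)%:C%C) w)| <=
  cabs (f w) `^ (p - 2) *
    (2 * p ^+ 2 * normDf f w ^+ 2 + p * (cabs (f w) * cabs (lap f w))).
Proof.
move=> wB.
have -> : complex.Re (lap (fun y => (cabs (f y) `^ p)%:C%C) w) =
    laplacian (fun y => cabs (f y) `^ p) w.
  apply: (Re_lap_real (F := fun y => cabs (f y) `^ p)) => j.
  by have D := is_derive_pow2 j wB; rewrite (pdR_val D).
have -> : laplacian (fun y => cabs (f y) `^ p) w =
    s * (s - 1) * \sum_j phi w `^ (s - 1 - 1) * psi j w ^+ 2 +
    s * phi w `^ (s - 1) * \sum_j e j w.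
  rewrite !mulr_sumr -big_split; apply: eq_bigr => j _.
  rewrite (pdR_val (is_derive_pow2 j wB)) /=.
  move: (_ `^ _) (_ `^ _) (psi j w) (e j w) => *; ring.
have -> : cabs (f w) `^ (p - 2) = phi w `^ (s - 1).
  by rewrite cabs_powR; congr powR; rewrite /s; field.
set T := phi w `^ (s - 1); have T0 : 0 <= T by exact: powR_ge0.
set S1 := \sum_j _; set S2 := \sum_j e j w.
have GG := normDf_sqr f w; rewrite -/u -/v in GG.
have S1le : 0 <= S1 <= T * (8 * normDf f w ^+ 2).
  apply/andP; split.
    by apply: sumr_ge0 => j _; rewrite mulr_ge0 ?powR_ge0 ?sqr_ge0.
  have -> : T * (8 * normDf f w ^+ 2) =
      \sum_j T * (4 * (pdR j u w ^+ 2 + pdR j v w ^+ 2)).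
    rewrite -!mulr_sumr big_split/= -/(grad_sq u w) -/(grad_sq v w) -GG.
    by move: (normDf f w) => Y; ring.
  apply: ler_sum => j _.
  have [p0|p0] := eqVneq (phi w) 0.
    by rewrite psi_eq0// expr0n/= mulr0 !mulr_ge0// addr_ge0 ?sqr_ge0.
  have pw : 0 < phi w by rewrite lt_def p0 phi_ge0.
  have -> : T = phi w `^ (s - 1 - 1) * phi w.
    rewrite /T -{3}(powRr1 (ltW pw)) -powRD ?(negbTE p0) ?implybT//.
    by congr powR; ring.
  rewrite -mulrA ler_wpM2l ?powR_ge0// /psi /phi.
  move: (u w) (v w) (pdR j u w) (pdR j v w) => a b c d.
  by have := sqr_ge0 (a * d - b * c); nra.
have S2E : S2 = 4 * normDf f w ^+ 2 +
    2 * (u w * laplacian u w + v w * laplacian v w).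
  have -> : 4 * normDf f w ^+ 2 = 2 * (2 * normDf f w ^+ 2).
    by move: (normDf f w) => Y; ring.
  rewrite GG /S2 /e /grad_sq /laplacian -mulr_sumr -mulrDr; congr (2 * _).
  by rewrite !mulr_sumr -!big_split; apply: eq_bigr => j _ /=; rewrite addrACA.
have fL : `|u w * laplacian u w + v w * laplacian v w| <= cabs (f w) * cabs (lap f w).
  have := norm_Re_mul_conj (f w) (lap f w).
  by rewrite (lap_C2 f2 wB).
rewrite S2E; move: fL S1le.
have Y0 := normDf_ge0 f w.
move: (normDf f w) (u w * _ + _) (cabs (f w) * _) Y0 => Y L K Y0.
rewrite ler_norml => /andP[L1 L2] /andP[S10 S11].
have sE : p = 2 * s by rewrite /s; field.
have ss1 : 0 <= s * (s - 1) by rewrite mulr_ge0// ltW.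
have A1 : 0 <= s * (s - 1) * S1 by rewrite mulr_ge0.
have A2 : s * (s - 1) * S1 <= s * (s - 1) * (T * (8 * Y ^+ 2)) by rewrite ler_wpM2l.
have sT : 0 <= s * T by rewrite mulr_ge0// ltW.
have B1 : s * T * - K <= s * T * L by rewrite ler_wpM2l.
have B2 : s * T * L <= s * T * K by rewrite ler_wpM2l.
have C1 : 0 <= s * T * Y ^+ 2 by rewrite mulr_ge0 ?sqr_ge0.
have D0 : 0 <= s * (s * T * Y ^+ 2) by rewrite mulr_ge0 ?sqr_ge0// ltW.
(* The constant 2 p^2 = 8 s^2 dominates 8 s (s - 1) + 4 s. *)
rewrite sE.
have -> : T * (2 * (2 * s) ^+ 2 * Y ^+ 2 + 2 * s * K) =
   8 * (s * (s * T * Y ^+ 2)) + 2 * (s * T * K) by ring.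
have -> : s * T * (4 * Y ^+ 2 + 2 * L) = 4 * (s * T * Y ^+ 2) + 2 * (s * T * L) by ring.
have A2' : s * (s - 1) * (T * (8 * Y ^+ 2)) =
  8 * (s * (s * T * Y ^+ 2)) - 8 * (s * T * Y ^+ 2) by ring.
have B1' : s * T * - K = - (s * T * K) by ring.
rewrite A2' in A2; rewrite B1' in B1.
by rewrite ler_norml; apply/andP; split; lra.
Qed.

End PowerLaplacian.

(** Everything is rescaled by e = D^q: the bounds on e a and e L become free of D, and X = e Y
    satisfies X^2 <= T^(2 / alpha) <= T + 1. The weight splits as e^(p-2) e^2, the bracket being
    quadratic in Y, a and L. *)
Lemma weighted_bound (R : realType) (D Y a L A B M C0 p q alpha gamma N : R) :
  0 < D <= 1 -> 0 <= Y -> 0 <= a -> 0 <= A -> 0 <= B -> 0 <= M -> 0 <= C0 ->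
  2 <= p -> 2 <= alpha -> alpha <= N -> q = (N + gamma) / alpha - 1 ->
  0 < gamma -> 0 <= L ->
  a <= C0 * D `^ (- q) -> L <= A * Y + B * a + M * D `^ (- q) ->
  D `^ (p * q) * (a `^ (p - 2) * (2 * p ^+ 2 * Y ^+ 2 + p * (a * L))) <=
  C0 `^ (p - 2) * (2 * p ^+ 2 + p * C0 * A) * (D `^ gamma * Y `^ alpha) +
  C0 `^ (p - 2) * (2 * p ^+ 2 + p * C0 * (2 * A + B * C0 + M)).
Proof.
move=> /andP[D0 D1] Y0 a0 A0 B0 M0 C00 p2 al2 alN qE gam0 L0 aC LC.
have al0 : 0 < alpha by exact: lt_le_trans al2.
pose e := D `^ q.
have e0 : 0 < e by exact: powR_gt0.
have eV : D `^ (- q) = e^-1 by rewrite powRN.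
have -> : D `^ (p * q) = e `^ (p - 2) * e ^+ 2.
  by rewrite -powR_mulrn ?(ltW e0)// -powRD ?(gt_eqF e0) ?implybT// subrK mulrC powRrM.
have ea : e * a <= C0.
  by move: aC; rewrite eV ler_pdivlMr// mulrC.
have ea0 : 0 <= e * a by rewrite mulr_ge0// ltW.
have -> : e `^ (p - 2) * e ^+ 2 *
    (a `^ (p - 2) * (2 * p ^+ 2 * Y ^+ 2 + p * (a * L))) =
  (e * a) `^ (p - 2) * (2 * p ^+ 2 * (e * Y) ^+ 2 + p * ((e * a) * (e * L))).
  rewrite powRM ?(ltW e0)//; move: (e `^ _) (a `^ _) => x y; ring.
set X := e * Y; have X0 : 0 <= X by rewrite mulr_ge0// ltW.
have eL : e * L <= A * X + B * C0 + M.
  apply: le_trans (ler_wpM2l (ltW e0) LC) _.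
  have -> : e * (A * Y + B * a + M * D `^ (- q)) = A * X + B * (e * a) + M.
    by rewrite eV /X; field; rewrite gt_eqF.
  by rewrite lerD2r lerD2l ler_wpM2l.
set T := D `^ gamma * Y `^ alpha.
have T0 : 0 <= T by rewrite mulr_ge0 ?powR_ge0.
have XT : X ^+ 2 <= T + 1.
  have -> : X ^+ 2 = D `^ (q * 2) * Y ^+ 2.
    by rewrite /X exprMn /e powRrM powR_mulrn// powR_ge0.
  apply: (@le_trans _ _ (T `^ (2 / alpha))).
    rewrite /T powRM ?powR_ge0// -!powRrM.
    have -> : alpha * (2 / alpha) = 2 by field; rewrite gt_eqF.
    rewrite powR_mulrn// ler_wpM2r ?sqr_ge0//.
    apply: ger_powR; first by rewrite D0.
    rewrite qE; have -> : ((N + gamma) / alpha - 1) * 2 =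
      gamma * (2 / alpha) + 2 * (N / alpha - 1) by field; rewrite gt_eqF.
    by rewrite lerDl mulr_ge0// subr_ge0 ler_pdivlMr// mul1r.
  have r1 : 2 / alpha <= 1 by rewrite ler_pdivrMr// mul1r.
  have [T1|T1] := leP 1 T.
    by apply: le_trans (ler1_powR T1 r1) _; rewrite lerDl.
  have : T `^ (2 / alpha) <= 1 `^ (2 / alpha).
    by rewrite ge0_ler_powR ?nnegrE ?divr_ge0 ?(ltW T1)// ltW.
  by rewrite powR1; lra.
have XX : X <= T + 2 by have := sqr_ge0 (X - 1); nra.
have p0 : 0 <= p by apply: le_trans p2.
have H1 : (e * a) `^ (p - 2) <= C0 `^ (p - 2).
  by rewrite ge0_ler_powR ?nnegrE// subr_ge0.
have H2 : (e * a) * (e * L) <= C0 * (A * (T + 2) + B * C0 + M).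
  rewrite ler_pM// ?mulr_ge0 ?(ltW e0)//; apply: le_trans eL _.
  by rewrite !lerD2r ler_wpM2l.
have Z0 : 0 <= 2 * p ^+ 2 * X ^+ 2 + p * (e * a * (e * L)).
  by rewrite addr_ge0// ?mulr_ge0 ?sqr_ge0 ?(ltW e0).
apply: (@le_trans _ _ (C0 `^ (p - 2) *
   (2 * p ^+ 2 * (T + 1) + p * (C0 * (A * (T + 2) + B * C0 + M))))).
  apply: ler_pM => //; first exact: powR_ge0.
  by apply: lerD; rewrite ler_wpM2l// mulr_ge0 ?sqr_ge0.
by rewrite le_eqVlt; apply/orP; left; apply/eqP; ring.
Qed.

Lemma half_sum_ge0 (R : realType) (a b c d : R) :
  2 * a <= c -> 2 * b <= d -> 0 <= 2^-1 * (a + b) -> 0 <= 2^-1 * (c + d).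
Proof. by lra. Qed.

(** * Growth of the gradient and of f, and the comparison of integrals *)

Section Estimates.
Variables (R : realType) (n : nat) (f : 'rV[R]_(n + n) -> R[i]).
Local Notation pt := 'rV[R]_(n + n).
Implicit Types w : pt.
Hypotheses (n1 : (1 <= n)%N) (f3 : CkC 3 f).

Let u := reF f.
Let v := imF f.
Let G w := 2^-1 * (grad_sq u w + grad_sq v w).

Lemma normDf_sqrE w : normDf f w ^+ 2 = G w.
Proof.
rewrite /G -normDf_sqr; move: (normDf f w) => Y.
by rewrite mulrA mulVf ?mul1r// pnatr_eq0.
Qed.

Lemma normDf_powR w r : G w `^ (r / 2) = normDf f w `^ r.
Proof.
rewrite -normDf_sqrE -powR_mulrn ?normDf_ge0// -powRrM.
by congr powR; field.
Qed.

Let CkC2 : CkC 2 f.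
Proof. by split; apply: CkR_pred; [exact: f3.1|exact: f3.2]. Qed.

Lemma cont_ball_weight (gamma alpha : R) : 0 <= alpha ->
  cont_ball (fun w => dist_bd w `^ gamma * normDf f w `^ alpha).
Proof.
move=> al0.
have cG : cont_ball G.
  move=> w wB; apply: continuousM; first exact: cst_continuous.
  by apply: continuousD; apply: cont_grad_sq => //;
    apply: CkR_pred; [exact: CkC2.1|exact: CkC2.2].
have -> : (fun w => dist_bd w `^ gamma * normDf f w `^ alpha) =
    fun w => dist_bd w `^ gamma * G w `^ (alpha / 2).
  by apply/funext => w; rewrite normDf_powR.
have G0 w : 0 <= G w by rewrite -normDf_sqrE sqr_ge0.
move=> w wB; apply: continuousM.
  have c : dist_bd y @[y --> w] --> dist_bd w by exact: continuous_dist_bd.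
  exact: (cvg_powR_gt0 _ (dist_bd_gt0 wB) c).
by apply: (cont_ball_powR G0 cG) => //; rewrite divr_ge0.
Qed.

Hypothesis sub_f : forall w, ball_n w ->
  0 <= complex.Re (\sum_(k < n) ((dz k f w)^* * dz k (lap f) w
                                + (dzb k f w)^* * dzb k (lap f) w))%C.

(** [subharmonic_growth] for G = |D|^2 with s = alpha / 2 bounds |D|^alpha; the root of order alpha
    yields the exponent q + 1. *)
Lemma normDf_growth (alpha gamma V : R) :
  2 <= alpha -> 0 < gamma ->
  (vint (on_ball (fun w => (dist_bd w `^ gamma * normDf f w `^ alpha)%R)) <= V%:E)%E ->
  exists2 C, 0 <= C & forall w, ball_n w ->
    normDf f w <= C * dist_bd w `^ (- (((2 * n)%:R + gamma) / alpha)).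
Proof.
move=> al2 gam0 hV.
have al0 : 0 < alpha by exact: lt_le_trans al2.
pose Gk k w := 2^-1 * (grad_sq1 u k w + grad_sq1 v k w).
pose Gkk k w := 2^-1 * (grad_sq2 u k w + grad_sq2 v k w).
have G0 w : 0 <= G w by rewrite -normDf_sqrE sqr_ge0.
have half (F1 F2 : pt -> R) : cont_ball F1 -> cont_ball F2 ->
    cont_ball (fun w => 2^-1 * (F1 w + F2 w)).
  move=> c1 c2 w wB; apply: continuousM; first exact: cst_continuous.
  by apply: continuousD; [exact: c1|exact: c2].
have dhalf (F1 F2 : pt -> R) w k d1 d2 :
    is_derive w (delta_mx ord0 k) F1 d1 -> is_derive w (delta_mx ord0 k) F2 d2 ->
    is_derive w (delta_mx ord0 k) (fun w => 2^-1 * (F1 w + F2 w)) (2^-1 * (d1 + d2)).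
  move=> h1 h2; have := is_derive_mul (is_derive_cst (2^-1 : R) w (delta_mx ord0 k))
    (is_derive_add h1 h2).
  by rewrite mul0r add0r.
have [u2 v2] := CkC2.
have [C C0 HC] : exists2 C, 0 <= C & forall z, ball_n z ->
    G z `^ (alpha / 2) <= C * dist_bd z `^ (- ((2 * n)%:R + gamma)).
  apply: (@subharmonic_growth _ _ G Gk Gkk G0 _ _ _ _ _ _ _ _ _ V n1 _ gam0 hV).
  - exact: (half _ _ (cont_grad_sq (CkR_pred u2)) (cont_grad_sq (CkR_pred v2))).
  - by move=> k; exact: (half _ _ (cont_grad_sq1 u2) (cont_grad_sq1 v2)).
  - by move=> k; exact: (half _ _ (cont_grad_sq2 f3.1) (cont_grad_sq2 f3.2)).
  - move=> k w wB.
    exact: (dhalf _ _ _ _ _ _ (is_derive_grad_sq k u2 wB) (is_derive_grad_sq k v2 wB)).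
  - move=> k w wB.
    exact: (dhalf _ _ _ _ _ _ (is_derive_grad_sq1 k f3.1 wB)
      (is_derive_grad_sq1 k f3.2 wB)).
  - move=> w wB; rewrite /Gkk -mulr_sumr big_split/=.
    have A := sum_grad_sq2_ge f3.1 wB; have B := sum_grad_sq2_ge f3.2 wB.
    have := sub_f wB; rewrite Re_grad_lap big_split/=.
    have EU j : pdR j (reF (lap f)) w = pdR j (laplacian u) w.
      apply: near_pdR; near=> y; rewrite /reF lap_C2//.
      by near: y; exact: near_ball_n.
    have EV j : pdR j (imF (lap f)) w = pdR j (laplacian v) w.
      apply: near_pdR; near=> y; rewrite /imF lap_C2//.
      by near: y; exact: near_ball_n.
    rewrite (eq_bigr _ (fun j _ => congr1 (fun x => pdR j (reF f) w * x) (EU j))).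
    rewrite [X in _ + X](eq_bigr _ (fun j _ =>
      congr1 (fun x => pdR j (imF f) w * x) (EV j))).
    exact: half_sum_ge0 A B.
  - by rewrite ler_pdivlMr// mul1r.
  - by move=> w wB; rewrite normDf_powR.
exists (C `^ alpha^-1); first exact: powR_ge0.
move=> w wB; have D0 := ltW (dist_bd_gt0 wB).
have := HC w wB; rewrite normDf_powR => H.
have -> : normDf f w = (normDf f w `^ alpha) `^ alpha^-1.
  by rewrite -powRrM mulfV ?gt_eqF// powRr1// normDf_ge0.
apply: le_trans (_ : (C * dist_bd w `^ (- ((2 * n)%:R + gamma))) `^ alpha^-1 <= _).
  by rewrite ge0_ler_powR ?nnegrE ?invr_ge0 ?(ltW al0) ?mulr_ge0 ?powR_ge0.
by rewrite powRM ?powR_ge0// -powRrM mulNr.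
Unshelve. all: by end_near. Qed.

Lemma cabs_growth (C q : R) : 0 <= C -> 0 < q ->
  (forall w, ball_n w -> normDf f w <= C * dist_bd w `^ (- (q + 1))) ->
  exists2 C0, 0 <= C0 & forall w, ball_n w -> cabs (f w) <= C0 * dist_bd w `^ (- q).
Proof.
move=> C0 q0 HC; have [u2 v2] := CkC2.
(* The factor 2 of [normDf_sqr] is enlarged to 4 so as to keep a square. *)
have H w : ball_n w -> grad_sq u w + grad_sq v w <=
    (2 * C * dist_bd w `^ (- (q + 1))) ^+ 2.
  move=> wB; rewrite -normDf_sqr -mulrA exprMn.
  have : normDf f w ^+ 2 <= (C * dist_bd w `^ (- (q + 1))) ^+ 2.
    by rewrite ler_pXn2r ?nnegrE ?normDf_ge0 ?mulr_ge0 ?powR_ge0//; exact: HC.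
  by move: (normDf f w) (C * _) => Y X; nra.
have gge0 (g : pt -> R) w : 0 <= grad_sq g w.
  by apply: sumr_ge0 => k _; exact: sqr_ge0.
have C2 : 0 <= 2 * C by rewrite mulr_ge0.
have Hu := radial_norm_bound (CkR_pred u2) C2 q0 (fun w wB =>
  le_trans (_ : grad_sq u w <= grad_sq u w + grad_sq v w) (H w wB)).
have Hv := radial_norm_bound (CkR_pred v2) C2 q0 (fun w wB =>
  le_trans (_ : grad_sq v w <= grad_sq u w + grad_sq v w) (H w wB)).
exists (`|u 0| + `|v 0| + 2 * (2 * C / q)).
  by rewrite !addr_ge0// mulr_ge0// divr_ge0// ltW.
move=> w wB.
(* As d <= 1, the constants |u(0)| and |v(0)| can be absorbed into d^(-q). *)
have D1 : 1 <= dist_bd w `^ (- q).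
  rewrite powRN invf_ge1 ?powR_gt0 ?dist_bd_gt0//.
  have : dist_bd w `^ q <= 1 `^ q.
    rewrite ge0_ler_powR ?nnegrE ?(ltW q0) ?dist_bd_le1//.
    by rewrite ltW// dist_bd_gt0.
  by rewrite powR1.
have hu : `|u w| <= `|u 0| + 2 * C / q * dist_bd w `^ (- q).
  by apply: Hu => // y; rewrite lerDl.
have hv : `|v w| <= `|v 0| + 2 * C / q * dist_bd w `^ (- q).
  by apply: Hv => // y; rewrite lerDr.
have hf : cabs (f w) <= `|u w| + `|v w|.
  rewrite -(@ler_pXn2r _ 2) ?nnegrE ?cabs_ge0 ?addr_ge0//.
  rewrite cabs_sqr sqrrD !real_normK ?num_real// lerD2r lerDl.
  by rewrite mulrn_wge0// mulr_ge0.
have u0 : `|u 0| <= `|u 0| * dist_bd w `^ (- q) by rewrite ler_peMr.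
have v0 : `|v 0| <= `|v 0| * dist_bd w `^ (- q) by rewrite ler_peMr.
have -> : forall a b c d : R, (a + b + 2 * c) * d = a * d + b * d + c * d + c * d.
  by move=> *; ring.
by lra.
Qed.

(** [H] is compared by monotonicity alone and may be discontinuous; the majorant is continuous, so
    cutoffs and linearity apply to it. *)
Lemma vint_weight_lty (h H : pt -> R) (K1 K2 V : R) :
  cont_ball h -> (forall w, ball_n w -> 0 <= h w) -> 0 <= K1 -> 0 <= K2 ->
  (vint (on_ball h) <= V%:E)%E ->
  (forall w, ball_n w -> 0 <= H w <= K1 * h w + K2) ->
  (vint (on_ball H) < +oo)%E.
Proof.
move=> ch h0 K10 K20 hV hH.
have le1 : (vint (on_ball H) <= vint (on_ball (fun w => (K1 * h w + K2)%R)))%E.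
  apply: (le_iint (F := fun x => on_ball H (\row_j x j)) _ _).2 => x.
    by apply: on_ball_ge0 => y /hH /andP[].
  have [xB|xB] := pselect (ball_n (\row_j x j)); last by rewrite !on_ballN.
  by rewrite !on_ballT// lee_fin; have /andP[] := hH _ xB.
apply: le_lt_trans le1 _.
apply: (@le_lt_trans _ _ (K1 * V + K2 * 2 ^+ (n + n))%:E); last exact: ltry.
have c1 : cont_ball (fun _ : pt => 1 : R) by move=> w _; exact: cst_continuous.
apply: vint_on_ball_le => [w wB|w wB|j].
- apply: continuousD; last exact: cst_continuous.
  by apply: continuousM; [exact: cst_continuous|exact: ch].
- by rewrite addr_ge0// mulr_ge0// h0.
have uh := ucc_cutoff_mul j ch; have u1 := ucc_cutoff_mul j c1.
have -> : rowint (fun w => cutoff j w * (K1 * h w + K2)) =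
    K1 * rowint (fun w => cutoff j w * h w) + K2 * rowint (fun w => cutoff j w * 1).
  rewrite /rowint -(iintR_scale K2)// -iintR_lin//; last exact: ucc_scale.
  by congr iintR; apply/funext => x; ring.
apply: lerD; rewrite ler_wpM2l ?rowint_cutoff_le//.
rewrite -lee_fin; apply: le_trans hV.
apply: rowint_le_vint => //.
- move=> w; have [wB|wB] := pselect (ball_n w); last by rewrite cutoff_out// mul0r.
  by rewrite mulr_ge0 ?cutoff_ge0 ?h0.
- by move=> w wB; rewrite ler_piMl ?h0 ?cutoff_le1.
- by move=> w wB; rewrite cutoff_out// mul0r.
Qed.

End Estimates.

Unset Implicit Arguments.

Theorem theorem1p8 (R : realType) (n : nat) (alpha gamma M : R)
    (f : 'rV[R]_(n + n) -> R[i]) (a b c : 'rV[R]_(n + n) -> R) :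
  (1 <= n)%N ->
  2 <= alpha -> alpha <= (2 * n)%:R ->
  0 < gamma ->
  0 <= M ->
  let q := ((2 * n)%:R + gamma) / alpha - 1 in
  CkC 3 f ->
  (forall w, ball_n w -> 0 <= a w /\ 0 <= b w /\ 0 <= c w) ->
  (forall w, ball_n w ->
     {for w, continuous a} /\ {for w, continuous b} /\ {for w, continuous c}) ->
  (exists A : R, forall w, ball_n w -> a w <= A) ->
  (exists B : R, forall w, ball_n w -> b w <= B) ->
  (forall w, ball_n w -> c w <= M * dist_bd w `^ (- q)) ->
  (forall w, ball_n w ->
     cabs (lap f w) <= a w * normDf f w + b w * cabs (f w) + c w) ->
  Dirichlet gamma alpha f ->
  (forall w, ball_n w -> 0 <= complex.Re (f w * (lap f w)^*)%C) ->
  (forall w, ball_n w ->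
     0 <= complex.Re (\sum_(k < n)
            ((dz k f w)^* * dz k (lap f) w
             + (dzb k f w)^* * dzb k (lap f) w))%C) ->
  forall p : R, 2 <= p ->
    (intVN (fun w : 'rV[R]_(n + n) => (`| dist_bd w `^ (p * q) *
         complex.Re (lap (fun w' => (cabs (f w') `^ p)%:C%C) w) |)%R) < +oo)%E.
Proof.
move=> n1 al2 aln gam0 M0 q f3 abc0 _ [A aA] [B bB] cM lapf Df _ subf p p2.
have al0 : 0 < alpha by exact: lt_le_trans al2.
(* From alpha <= 2n and gamma > 0; the radial integration divides by q. *)
have q0 : 0 < q.
  by rewrite /q subr_gt0 ltr_pdivlMr// mul1r; lra.
have f2 : CkC 2 f by split; apply: CkR_pred; [exact: f3.1|exact: f3.2].
(* The origin serves as a point where the bounds [A] and [B] dominate nonnegative values. *)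
have zB : ball_n (0 : 'rV[R]_(n + n)).
  rewrite /ball_n/= enormE (_ : sqn 0 = 0) ?sqrtr0// /sqn big1// => i _.
  by rewrite mxE expr0n.
have A0 : 0 <= A by apply: le_trans (aA _ zB); exact: (abc0 _ zB).1.
have B0 : 0 <= B by apply: le_trans (bB _ zB); exact: (abc0 _ zB).2.1.
pose h (w : 'rV[R]_(n + n)) := dist_bd w `^ gamma * normDf f w `^ alpha.
have h0 w : 0 <= h w by rewrite mulr_ge0 ?powR_ge0.
have hfin : (vint (on_ball h) < +oo)%E by apply/intVN_lty => //; exact: Df.2.
have hV : (vint (on_ball h) <= (fine (vint (on_ball h)))%:E)%E.
  rewrite fineK// ge0_fin_numE//.
  apply: (le_iint (F := fun x => on_ball h (\row_j x j)) _ (fun x => lexx _)).1 => x.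
  by apply: on_ball_ge0.
have [C C0 HC] := normDf_growth n1 f3 subf al2 gam0 hV.
have q1 : q + 1 = ((2 * n)%:R + gamma) / alpha by rewrite /q subrK.
rewrite -q1 in HC.
have [C' C'0 HC'] := cabs_growth f3 C0 q0 HC.
have p0 : 0 <= p by apply: le_trans p2.
apply/intVN_lty => //.
apply: (@vint_weight_lty _ _ h _ (C' `^ (p - 2) * (2 * p ^+ 2 + p * C' * A))
  (C' `^ (p - 2) * (2 * p ^+ 2 + p * C' * (2 * A + B * C' + M)))
  (fine (vint (on_ball h)))) => //.
- exact: (cont_ball_weight f3 (ltW al0)).
- by rewrite mulr_ge0 ?powR_ge0// addr_ge0 ?mulr_ge0 ?sqr_ge0.
- by rewrite mulr_ge0 ?powR_ge0// addr_ge0 ?mulr_ge0 ?addr_ge0 ?mulr_ge0 ?sqr_ge0.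
move=> w wB; rewrite normr_ge0/= normrM ger0_norm ?powR_ge0//.
apply: le_trans (ler_wpM2l (powR_ge0 _ _) (norm_lap_powR_le f2 p2 wB)) _.
have D0 := dist_bd_gt0 wB; have [a0 [b0 c0]] := abc0 w wB.
apply: (@weighted_bound _ _ _ _ _ A B M C' p q alpha gamma (2 * n)%:R) => //.
- by rewrite D0 dist_bd_le1.
- exact: normDf_ge0.
- exact: cabs_ge0.
- exact: cabs_ge0.
- exact: HC'.
- apply: le_trans (lapf w wB) _; apply: lerD; last exact: cM.
  by apply: lerD; rewrite ler_wpM2r ?normDf_ge0 ?cabs_ge0 ?aA ?bB.
Qed.
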